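(* Let $n\ge 3$. The marked fan $(\varphi_n(\mathcal{M}_{0,n,\mathrm{trop}}),\{v_I\})$ is a tropical fan in $Q_n$ with lattice $\Lambda_n$. In other words, using the embedding $\varphi_n$, the space $\mathcal{M}_{0,n,\mathrm{trop}}$ can be thought of as a tropical fan of dimension $n-3$.
   Context: Tropical curves. A (rational, abstract) tropical curve is a finite connected metric graph $\Gamma$ of genus $0$ (a tree) all of whose vertices have valence at least $3$; its edges are either bounded, with a length $l(E)\in\mathbb{R}_{>0}$, or unbounded (called ends), isometric to $[0,\infty)$ and attached to one vertex. $\mathcal{M}_{0,n,\mathrm{trop}}$ is the set of isomorphism classes of tuples $(\Gamma,x_1,\dots,x_n)$, where $\Gamma$ is a tropical curve with exactly $n$ ends and $x_1,\dots,x_n$ are its distinct ends; isomorphisms are homeomorphisms that map the $i$-th end to the $i$-th end and each edge isometrically onto an edge. The combinatorial type is the homeomorphism class of $\Gamma$ relative to $x_1,\dots,x_n$ (i.e. lengths are forgotten). Embedding. Let $[n]=\{1,\dots,n\}$ and let $\mathbb{R}^{\binom n2}$ have coordinates indexed by the 2-element subsets of $[n]$. Let $\operatorname{dist}_n:\mathcal{M}_{0,n,\mathrm{trop}}\to\mathbb{R}^{\binom n2}$ send $(\Gamma,x_1,\dots,x_n)$ to $(\operatorname{dist}_\Gamma(x_i,x_j))_{\{i,j\}}$, where $\operatorname{dist}_\Gamma(x_i,x_j)$ is the sum of the lengths of the bounded edges on the unique path from $x_i$ to $x_j$. Let $\Phi_n:\mathbb{R}^n\to\mathbb{R}^{\binom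 n2}$, $a\mapsto(a_i+a_j)_{\{i,j\}}$, let $Q_n:=\mathbb{R}^{\binom n2}/\operatorname{Im}(\Phi_n)$ with projection $q_n$, and $\varphi_n:=q_n\circ\operatorname{dist}_n$. It is known (Speyer–Sturmfels) that $\varphi_n$ is an embedding whose image is (the support of) a simplicial fan of pure dimension $n-3$; its cones correspond to combinatorial types, the relative interior of a $k$-dimensional cone consisting of the images of the curves of one type with exactly $k$ bounded edges. Marking and lattice. For $I\subset[n]$ with $1<|I|<n-1$ let $v_I=v_{[n]\setminus I}\in Q_n$ be the image under $\varphi_n$ of the tree with exactly one bounded edge, of length $1$, with the ends labeled by $I$ on one side of it and those labeled by $[n]\setminus I$ on the other. The vectors $v_I$ generate the one-dimensional cones of $\varphi_n(\mathcal{M}_{0,n,\mathrm{trop}})$. $\Lambda_n:=\langle v_I\rangle_{\mathbb{Z}}\subset Q_n$ is the lattice generated by them. Fans. Let $\Lambda$ be a lattice in $V=\Lambda\otimes\mathbb{R}$. A cone in $V$ is a set defined by finitely many linear equalities $f_i(x)=0$ and inequalities $g_j(x)\ge0$ with $f_i,g_j\in\Lambda^\vee$; its faces are obtained by changing some inequalities to equalities. For a cone $\sigma$, $V_\sigma$ is its linear span, $\Lambda_\sigma=V_\sigma\cap\Lambda$, $\dim\sigma=\dim V_\sigma$; $\sigma$ is simplicial if generated by $\dim\sigma$ vectors. A fan is a finite set of cones closed under faces with pairwise intersections being faces of each; $X^{(k)}$ is the set of its $k$-dimensional cones. For $\tau<\sigma$ of codimension one, $u_{\sigma/\tau}\in\Lambda_\sigma/\Lambda_\tau\cong\mathbb{Z}$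 is the generator on the side of $\sigma$. A weighted fan is a pure $m$-dimensional fan $X$ with $\omega_X:X^{(m)}\to\mathbb{Z}_{>0}$; it is tropical if $\sum_{\sigma>\tau}\omega_X(\sigma)u_{\sigma/\tau}=0\in V/V_\tau$ for all $\tau\in X^{(m-1)}$. A marked fan is a pure-dimensional simplicial fan $X$ with a choice of vectors $v_\rho\in(\rho\setminus\{0\})\cap\Lambda$ for all $\rho\in X^{(1)}$; it is regarded as a weighted fan with $\omega(\sigma):=|\Lambda_\sigma/\tilde\Lambda_\sigma|$, where $\tilde\Lambda_\sigma\subset\Lambda_\sigma$ is the sublattice generated by the $v_\rho$ for the one-dimensional faces $\rho$ of $\sigma$. *)

(* Defs.v *)
From HB Require Import structures.
From mathcomp Require Import all_boot all_order all_algebra.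
From mathcomp Require Import finmap.
From mathcomp Require Import boolp classical_sets functions cardinality fsbigop.
From mathcomp Require Import reals.

Set Implicit Arguments.
Unset Strict Implicit.
Unset Printing Implicit Defensive.

Import Order.TTheory GRing.Theory Num.Theory.
Local Open Scope quotient_scope.
Local Open Scope classical_set_scope.
Local Open Scope ring_scope.

Section QuotientSpace.
Variables (K : fieldType) (V : vectType K) (U : {vspace V}).

Definition quotv := Quotient.quot (pred_of_vspace U : zmodClosed V).

HB.instance Definition _ := GRing.Zmodule.on quotv.

Definition qproj (x : V) : quotv := \pi x.

Lemma qproj_is_zmod_morphism : zmod_morphism qproj.
Proof. by move=> x y; rewrite /qproj !piE. Qed.

HB.instance Definition _ :=
  GRing.isZmodMorphism.Build V quotv qproj qproj_is_zmod_morphism.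

Lemma qproj_eq x y : (qproj x == qproj y) = (x - y \in U).
Proof. by rewrite /qproj -(Quotient.idealrBE U). Qed.

Lemma qproj_eq0 x : (qproj x == 0) = (x \in U).
Proof. by rewrite -(raddf0 qproj) qproj_eq subr0. Qed.

Lemma qproj_surj (y : quotv) : exists x, qproj x = y.
Proof. by exists (repr y); rewrite /qproj reprK. Qed.

Definition quotv_scale (a : K) (y : quotv) : quotv := qproj (a *: repr y).

Lemma quotv_scaleE a x : quotv_scale a (qproj x) = qproj (a *: x).
Proof.
apply/eqP; rewrite qproj_eq -scalerBr rpredZ // -qproj_eq.
by rewrite /qproj reprK.
Qed.

Fact quotv_scaleA a b y :
  quotv_scale a (quotv_scale b y) = quotv_scale (a * b) y.
Proof. by have [x <-] := qproj_surj y; rewrite !quotv_scaleE scalerA. Qed.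

Fact quotv_scale1 : left_id 1 quotv_scale.
Proof. by move=> y; have [x <-] := qproj_surj y; rewrite quotv_scaleE scale1r. Qed.

Fact quotv_scaleDr : right_distributive quotv_scale +%R.
Proof.
move=> a y z; have [x <-] := qproj_surj y; have [x' <-] := qproj_surj z.
by rewrite -raddfD !quotv_scaleE scalerDr raddfD.
Qed.

Fact quotv_scaleDl y : {morph quotv_scale^~ y : a b / a + b}.
Proof.
by move=> a b; have [x <-] := qproj_surj y; rewrite !quotv_scaleE scalerDl raddfD.
Qed.

HB.instance Definition _ := GRing.Zmodule_isLmodule.Build K quotv
  quotv_scaleA quotv_scale1 quotv_scaleDr quotv_scaleDl.

Fact qproj_is_scalable : scalable qproj.
Proof. by move=> a x; rewrite -quotv_scaleE. Qed.

HB.instance Definition _ :=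
  GRing.isScalable.Build K V quotv *:%R qproj qproj_is_scalable.

Let W := (U^C)%VS.

Fact quotv_vect_iso : Vector.axiom (\dim W) quotv.
Proof.
have [f f_lin f_bij] := subvs_vect_iso W.
have capWU : (W :&: U = 0)%VS by rewrite capvC capv_compl.
pose h (y : quotv) := vsproj W (daddv_pi W U (repr y)).
have hE x : h (qproj x) = vsproj W (daddv_pi W U x).
  rewrite /h; congr vsproj; apply/eqP; rewrite -subr_eq0 -linearB /=.
  set d := _ - x; have dU : d \in U by rewrite -qproj_eq /qproj reprK.
  have dWU : d \in (W + U)%VS by apply: subvP dU; apply: addvSr.
  have /esym/eqP := daddv_pi_add capWU dWU.
  by rewrite (daddv_pi_id (etrans (capvC U W) capWU) dU) -subr_eq subrr eq_sym.
exists (f \o h).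
  move=> a y z; have [x <-] := qproj_surj y; have [x' <-] := qproj_surj z.
  by rewrite -linearZ -linearD /= !hE 2!linearP f_lin.
have [g fK gK] := f_bij; exists (qproj \o vsval \o g).
  move=> y; have [x <-] := qproj_surj y; rewrite /= hE fK.
  apply/eqP; rewrite vsprojK ?memv_pi // qproj_eq -opprB rpredN.
  have xWU : x \in (W + U)%VS by rewrite addvC addv_complf memvf.
  rewrite -{1}(daddv_pi_add capWU xWU) addrAC subrr add0r.
  exact: memv_pi.
move=> r /=; rewrite hE daddv_pi_id // ?subvsP // vsvalK; exact: gK.
Qed.

HB.instance Definition _ := Lmodule_hasFinDim.Build K quotv quotv_vect_iso.

End QuotientSpace.

Section Fans.
Variables (R : realType) (V : vectType R).
Implicit Types (L A C F : set V) (X : set (set V)).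

Definition zspan A : set V :=
  [set x | exists2 s : seq (int * V), (forall p, p \in s -> A p.2) &
     x = \sum_(p <- s) p.2 *~ p.1].

Definition is_lattice L :=
  exists2 b : seq V, basis_of fullv b & L = zspan [set` b].

Definition dual_lattice L : set 'Hom(V, R^o) :=
  [set f | forall x, L x -> f x \is a Num.int].

Definition halfspaces_inter (fs gs : seq 'Hom(V, R^o)) : set V :=
  [set x | (forall f, f \in fs -> f x = 0) /\ (forall g, g \in gs -> 0 <= g x :> R)].

Definition is_cone L C :=
  exists fs gs, [/\ [set` fs] `<=` dual_lattice L, [set` gs] `<=` dual_lattice L
                  & C = halfspaces_inter fs gs].

(** The inequalities in [gs'] are the ones turned into equalities; the set of
    faces of a cone does not depend on the chosen description [fs], [gs]. *)
Definition is_face L F C :=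
  exists fs gs gs',
    [/\ [set` fs] `<=` dual_lattice L, [set` gs] `<=` dual_lattice L,
        {subset gs' <= gs}, C = halfspaces_inter fs gs
      & F = halfspaces_inter (fs ++ gs') gs].

Definition is_linspan (A : set V) (U : {vspace V}) :=
  (forall x, A x -> x \in U) /\
  (forall W : {vspace V}, (forall x, A x -> x \in W) -> (U <= W)%VS).

Definition linspan A : {vspace V} := xget 0%VS (is_linspan A).

Lemma linspanP A : is_linspan A (linspan A).
Proof.
apply: (@xgetPex _ 0%VS (is_linspan A)).
have hk : exists k, `[< exists2 s : seq V, [set` s] `<=` A & \dim <<s>>%VS = k >].
  by exists (\dim (<<[::] : seq V>>%VS)); apply/asboolP; exists [::].
have hb k : `[< exists2 s : seq V, [set` s] `<=` A & \dim <<s>>%VS = k >] ->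
    (k <= \dim {:V})%N.
  by move=> /asboolP[s _ <-]; rewrite dimvS ?subvf.
have [k /asboolP[s sA dims] kmax] := ex_maxnP hk hb.
exists <<s>>%VS; split=> [x Ax|W AW].
  have xsA : [set` x :: s] `<=` A.
    by move=> y; rewrite /= inE => /orP[/eqP-> //|]; apply: sA.
  have le : (\dim <<x :: s>> <= k)%N.
    by apply: kmax; apply/asboolP; exists (x :: s).
  have sub : (<<s>> <= <<x :: s>>)%VS by rewrite span_cons addvSr.
  have /eqP -> : <<s>>%VS == <<x :: s>>%VS by rewrite eqEdim sub dims.
  by rewrite memv_span // mem_head.
by apply/span_subvP => y ys; apply/AW/sA.
Qed.

Definition cdim C : nat := \dim (linspan C).

Definition sublattice L C : set V := [set` linspan C] `&` L.

Definition cone_gen (s : seq V) : set V :=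
  [set x | exists2 c : 'I_(size s) -> R, (forall i, 0 <= c i) &
     x = \sum_i c i *: s`_i].

Definition simplicial C := exists2 s, size s = cdim C & C = cone_gen s.

Definition is_fan L X :=
  [/\ finite_set X,
      forall C, X C -> is_cone L C,
      forall C F, X C -> is_face L F C -> X F
    & forall C C', X C -> X C' ->
        is_face L (C `&` C') C /\ is_face L (C `&` C') C'].

Definition kcones X k : set (set V) := [set C | X C /\ cdim C = k].

Definition pure_dim X m :=
  forall C, X C -> (forall C', X C' -> C `<=` C' -> C' = C) -> cdim C = m.

(** [u] is the class u_(C/F) for a codimension-one face [F] of [C]. It lives in
    V / V_F, where the image of Lambda_C is Lambda_C / Lambda_F; these
    conditions determine it uniquely. *)
Definition is_primitive_normal L F C (u : quotv (linspan F)) :=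
  range (fun k : int => u *~ k) = @qproj _ V (linspan F) @` sublattice L C /\
  (@qproj _ V (linspan F) @` C) u.

Definition weighted_fan L X m (w : set V -> nat) :=
  [/\ is_fan L X, pure_dim X m & forall C, kcones X m C -> (0 < w C)%N].

Definition tropical_fan L X m (w : set V -> nat) :=
  weighted_fan L X m w /\
  forall F, X F -> (cdim F).+1 = m ->
    let star := kcones X m `&` [set C | is_face L F C] in
    exists2 u : set V -> quotv (linspan F),
      (forall C, star C -> is_primitive_normal L C (u C)) &
      \sum_(C \in star) u C *+ w C = 0.

(** A marking is given by a function on cones; only its values on
    one-dimensional cones matter. *)
Definition marked_fan L X m (v : set V -> V) :=
  [/\ is_fan L X, pure_dim X m, forall C, X C -> simplicial C
    & forall r, kcones X 1 r -> [/\ r (v r), v r <> 0 & L (v r)]].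

Definition marked_sublattice L (v : set V -> V) C : set V :=
  zspan (v @` [set r | is_face L r C /\ cdim r = 1%N]).

Definition cosets A (B : set V) : set (set V) :=
  [set [set x + y | y in B] | x in A].

(** The index |Lambda_C / Lambda~_C|, with value 0 when it is infinite; that
    case is excluded by the positivity of weights in [weighted_fan]. *)
Definition marked_weight L (v : set V -> V) C : nat :=
  #|` fset_set (cosets (sublattice L C) (marked_sublattice L v C))|.

End Fans.

(** A combinatorial type: since the genus is 0 there are no loops or multiple
    edges, so the bounded edges form a simple graph on the vertices; end [i] is
    attached to the vertex [end_at i]. *)
Record tree_type (n : nat) := TreeType {
  vert :> finType;
  adj : rel vert;
  end_at : 'I_n -> vert;
  adj_sym : symmetric adj;
  adj_irr : irreflexive adj;
  adj_connected : forall x y, connect adj x y;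
  adj_acyclic : forall c, cycle adj c -> uniq c -> (size c <= 2)%N;
  valence_ge3 : forall x,
    (3 <= #|[set y | adj x y]%SET| + #|[set i | end_at i == x]%SET|)%N }.

Section TreeDistance.
Variables (R : realType) (n : nat) (T : tree_type n).

Definition simple_path (x y : T) (p : seq T) :=
  [&& path (@adj n T) x p, last x p == y & uniq (x :: p)].

Lemma simple_path_exists x y : exists p, simple_path x y p.
Proof.
have /connectP[p xp ->] := adj_connected x y.
by case/shortenP: xp => q xq uq _; exists q; rewrite /simple_path xq uq eqxx.
Qed.

Definition tree_path x y : seq T := xchoose (simple_path_exists x y).

Definition tree_dist (len : {set T} -> R) (x y : T) : R :=
  \sum_(d <- pairmap (fun a b => len [set a; b]%SET) x (tree_path x y)) d.

End TreeDistance.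

Record trop_curve (R : realType) (n : nat) := TropCurve {
  curve_type :> tree_type n;
  len : {set curve_type} -> R;
  len_gt0 : forall x y, adj x y -> 0 < len [set x; y]%SET }.

(** All vertices have valence at least 3, so a homeomorphism of curves with at
    least 3 ends maps vertices to vertices. The function [len] is only
    meaningful on the pairs [set x; y] with [adj x y]. *)
Definition curve_iso (R : realType) (n : nat) (G H : trop_curve R n) :=
  exists f : G -> H,
    [/\ bijective f,
        forall x y, adj (f x) (f y) = adj x y,
        forall i, f (end_at G i) = end_at H i
      & forall x y, adj x y ->
          @len R n H [set f x; f y]%SET = @len R n G [set x; y]%SET].

Section ModuliFan.
Variables (R : realType) (n : nat).

(** the 2-element subsets {i, j} of [n], represented with i < j *)
Definition pair_index := {p : 'I_n * 'I_n | (p.1 < p.2)%N}.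

Definition dist_space := {ffun pair_index -> R^o}.

HB.instance Definition _ := Vector.on dist_space.

Definition Phi (a : {ffun 'I_n -> R^o}) : dist_space :=
  [ffun p => a (val p).1 + a (val p).2].

Lemma Phi_is_linear : linear Phi.
Proof.
move=> k a b; apply/ffunP => p; rewrite !ffunE scalerDr.
by rewrite !addrA; congr (_ + _); rewrite addrAC.
Qed.

HB.instance Definition _ :=
  GRing.isLinear.Build R {ffun 'I_n -> R^o} dist_space *:%R Phi Phi_is_linear.

Definition Qn := quotv (limg (linfun Phi)).

HB.instance Definition _ := Vector.on Qn.

Definition dist_vec (T : tree_type n) (len : {set T} -> R) : dist_space :=
  [ffun p => tree_dist len (end_at T (val p).1) (end_at T (val p).2)].

Definition phi (G : trop_curve R n) : Qn := qproj _ (dist_vec (@len R n G)).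

(** The cone of a combinatorial type: the closure of the set of images of the
    curves of this type, obtained by allowing edges of length 0. *)
Definition type_cone (T : tree_type n) : set Qn :=
  [set qproj _ (dist_vec len) | len in
    [set len : {set T} -> R | forall x y, adj x y -> 0 <= len [set x; y]%SET]].

Definition moduli_fan : set (set Qn) :=
  [set C | exists T : tree_type n, C = type_cone T].

Definition moduli_image : set Qn :=
  [set q | exists G : trop_curve R n, q = phi G].

End ModuliFan.

Arguments moduli_fan : clear implicits.
Arguments moduli_image : clear implicits.

Definition end_split (n : nat) := {I : {set 'I_n} | (1 < #|I| < n.-1)%N}.

Section OneEdgeCurve.
Variables (R : realType) (n : nat) (I : end_split n).

Let adj2 : rel bool := fun x y => x != y.
Let end2 (i : 'I_n) : bool := i \in val I.

Fact adj2_sym : symmetric adj2. Proof. by do 2![case]. Qed.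
Fact adj2_irr : irreflexive adj2. Proof. by case. Qed.

Fact adj2_connected x y : connect adj2 x y.
Proof. by move: x y => [] [] //; apply: connect1. Qed.

Fact adj2_acyclic c : cycle adj2 c -> uniq c -> (size c <= 2)%N.
Proof. by move=> _ /card_uniqP <-; rewrite -card_bool max_card. Qed.

Fact adj2_valence x :
  (3 <= #|[set y | adj2 x y]%SET| + #|[set i | end2 i == x]%SET|)%N.
Proof.
have -> : #|[set y | adj2 x y]%SET| = 1%N.
  by apply/eqP/cards1P; exists (~~ x); apply/setP => y; rewrite !inE; case: x y => [] [].
have /andP[I1 I2] := valP I; rewrite add1n ltnS.
case: x; first by apply: (leq_trans I1); apply/subset_leq_card/fintype.subsetP => i; rewrite !inE /end2 => ->.
have -> : [set i | end2 i == false]%SET = (~: val I)%SET.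
  by apply/setP => i; rewrite !inE eqbF_neg.
have E : (#|val I| + #|(~: val I)%SET| = n)%N by rewrite cardsC card_ord.
by rewrite -(ltn_add2l #|val I|) addn1 E -ltn_predRL.
Qed.

Definition one_edge_type : tree_type n :=
  TreeType adj2_sym adj2_irr adj2_connected adj2_acyclic adj2_valence.

Fact one_edge_len_gt0 (x y : one_edge_type) :
  adj x y -> 0 < (fun _ : {set one_edge_type} => 1 : R) [set x; y]%SET.
Proof. by rewrite ltr01. Qed.

Definition one_edge_curve : trop_curve R n := TropCurve one_edge_len_gt0.

Definition split_vec : Qn R n := phi one_edge_curve.

End OneEdgeCurve.

Arguments split_vec : clear implicits.

Section ModuliMarking.
Variables (R : realType) (n : nat).

Definition split_lattice : set (Qn R n) := zspan (range (split_vec R n)).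

(** Distinct v_I generate distinct rays, so at most one v_I qualifies; the
    default value 0 is never a legal marking. *)
Definition split_marking (r : set (Qn R n)) : Qn R n :=
  xget 0 [set v | range (split_vec R n) v /\ r = cone_gen [:: v]].

End ModuliMarking.

Arguments split_lattice : clear implicits.
Arguments split_marking : clear implicits.

(* Main.v *)
Require Import Defs.
From HB Require Import structures.
From mathcomp Require Import all_boot all_order all_algebra.
From mathcomp Require Import finmap zify ring.
From mathcomp Require Import boolp classical_sets cardinality fsbigop reals.
From mathcomp Require Import fintype finset.

(** The theorem reduces to set systems once an end [r] is chosen as a root. A
    bounded edge of a tree becomes a cluster, the set of ends on the side of the
    edge away from [r]. The clusters of a tree form a hierarchy: any two are
    nested or disjoint ([leafsets_hierarchy]). Conversely every hierarchy comes
    from a tree ([hierarchy_tree_leafsets]), which it determines up to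
    isomorphism ([leafsets_curve_iso]). Since a distance is the sum of the
    lengths of the separating edges ([tree_distE]), the point of a curve in the
    quotient is the combination of the vectors v_I of its clusters with the edge
    lengths as coefficients. Hence the cones of the fan are the cones [hcone F]
    spanned by the v_I for I in a hierarchy [F] ([type_coneE], [moduli_fanP]).

    On the quotient there are linear coordinates, the Gromov products
    (a|b) = (d(a,r) + d(b,r) - d(a,b)) / 2 for pairs {a, b} of ends other than
    [r], defined up to a common constant. In these coordinates v_I is the
    indicator function of the pairs contained in I. Thus the lattice generated
    by the v_I is the integral lattice modulo constants, and the vectors of all
    pairs but one are a basis of it ([split_lattice_is_lattice]).

    Let I be a cluster of a hierarchy [F]. Choose a and b in different children
    of I, and c in the parent of I but outside I. The functional (a|b) - (a|c)
    is integral, takes the value 1 at v_I and vanishes at v_J for all other J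
    in [F] ([dual_triple], [hierarchy_dual]). So the generators of a cone are
    part of a lattice basis. This makes every cone simplicial and rational, with
    the cones of subhierarchies as faces ([cone_face], [face_cone]), and all
    weights equal 1 ([marked_weight_hcone]). A similar functional recovers the
    clusters in the support of a point, and their coefficients, from the point
    alone ([hcone_support], [hcone_coef]). This gives the injectivity of the
    embedding, and that two cones meet in the cone of the common clusters
    ([hcone_setI]).

    Counting children shows that a hierarchy has at most n - 3 clusters, that a
    smaller one has a node with at least three children, and that for n - 4
    clusters there is one such node J and it has exactly three ([sum_excess]).
    The three refinements of the latter hierarchy add J without one child K,
    and the sum of the v_(J \ K) equals v_J plus the sum of the v_K
    ([ternary_balance]), which lies in the span of the smaller cone. That is the
    balancing condition. *)

Set Implicit Arguments.
Unset Strict Implicit.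
Unset Printing Implicit Defensive.

Import Order.TTheory GRing.Theory Num.Theory.
Local Open Scope ring_scope.

(** * Cones generated by part of a lattice basis *)

Section IntegralSpan.
Local Open Scope classical_set_scope.
Variables (R : realType) (V : vectType R).
Implicit Types (A : set V) (x y : V).

Lemma zspan_gen A x : A x -> zspan A x.
Proof.
move=> Ax; exists [:: (1, x)]; last by rewrite big_seq1 mulr1z.
by move=> p; rewrite inE => /eqP->.
Qed.

Lemma zspan0 A : zspan A 0.
Proof. by exists [::]; rewrite ?big_nil. Qed.

Lemma zspanD A x y : zspan A x -> zspan A y -> zspan A (x + y).
Proof.
move=> [s sA ->] [t tA ->]; exists (s ++ t); last by rewrite big_cat.
by move=> p; rewrite mem_cat => /orP[/sA|/tA].
Qed.

Lemma zspanMz A x (k : int) : zspan A x -> zspan A (x *~ k).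
Proof.
move=> [s sA ->]; exists [seq (p.1 * k, p.2) | p <- s].
  by move=> p /mapP[q /sA qA ->].
rewrite big_map; apply: (big_rec2 (fun a b => a *~ k = b)); first by rewrite mul0rz.
by move=> p a b _ <-; rewrite mulrzDl mulrzA.
Qed.

Lemma zspan_sum A (I : Type) (s : seq I) (P : pred I) (f : I -> V) :
  (forall i, P i -> zspan A (f i)) -> zspan A (\sum_(i <- s | P i) f i).
Proof. by move=> H; apply: big_ind => //; [exact: zspan0|exact: zspanD]. Qed.

Lemma zspan_sub A B : A `<=` zspan B -> zspan A `<=` zspan B.
Proof.
move=> AB x [s sA ->]; rewrite big_seq; apply: zspan_sum => p /sA/AB.
exact: zspanMz.
Qed.

Lemma dual_zspan A (f : 'Hom(V, R^o)) :
  (forall x, A x -> f x \is a Num.int) -> dual_lattice (zspan A) f.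
Proof.
move=> fA _ [s sA ->]; rewrite big_seq raddf_sum; apply: rpred_sum => p /sA/fA.
by rewrite raddfMz => h; apply: rpredMz.
Qed.

End IntegralSpan.

Section UnimodularCones.
Local Open Scope classical_set_scope.
Variables (R : realType) (V : vectType R) (K : finType) (v : K -> V).
Implicit Types (F G : {set K}) (x : V) (C : set V).

Definition cone F : set V :=
  [set x | exists2 c : K -> R, (forall i, i \in F -> 0 <= c i) &
     x = \sum_(i in F) c i *: v i].

Lemma mem_cone F i : i \in F -> cone F (v i).
Proof.
move=> iF; exists (fun j => (j == i)%:R) => [j _|]; first exact: ler0n.
rewrite (bigD1 i) //= eqxx scale1r big1 ?addr0 // => j /andP[_ /negPf->].
by rewrite scale0r.
Qed.

Lemma cone_gen_seq (s : seq K) : uniq s -> cone_gen [seq v i | i <- s] =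
  [set x | exists2 c : K -> R, (forall i, i \in s -> 0 <= c i) &
     x = \sum_(i <- s) c i *: v i].
Proof.
case: s => [|x0 s'] us.
  by apply/seteqP; split=> x [c c0 ->]; exists (fun=> 0) => //; rewrite ?big_ord0 ?big_nil.
set s := x0 :: s' in us *; have sum_nth (c : K -> R) : \sum_(k < size [seq v i | i <- s])
    c (nth x0 s k) *: [seq v i | i <- s]`_k = \sum_(i <- s) c i *: v i.
  rewrite -(big_mkord xpredT (fun k => c (nth x0 s k) *: [seq v i | i <- s]`_k)).
  rewrite size_map [RHS](big_nth x0) !big_nat; apply: eq_bigr => k /andP[_ ks].
  by rewrite (nth_map x0).
apply/seteqP; split=> x [c c0 ->]; last first.
  exists (fun k : 'I_(size [seq v i | i <- s]) => c (nth x0 s k)); last by rewrite sum_nth.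
  by move=> [k /= ks]; apply: c0; rewrite mem_nth // -(size_map v).
pose c' i := if insub (index i s) is Some k then c k else 0.
exists c'; first by move=> i _; rewrite /c'; case: insubP.
rewrite -sum_nth; apply: eq_bigr => k _; congr (_ *: _); rewrite /c' index_uniq //.
  by rewrite valK.
by rewrite -(size_map v s).
Qed.

Lemma cone_genE F : cone_gen [seq v i | i <- enum F] = cone F.
Proof.
rewrite cone_gen_seq ?enum_uniq //; apply/seteqP; split=> x [c c0 ->].
  by exists c; [move=> i iF; apply: c0; rewrite mem_enum | rewrite big_enum].
by exists c; [move=> i; rewrite mem_enum; apply: c0 | rewrite big_enum].
Qed.

Lemma cone_set1 i : cone [set i]%SET = cone_gen [:: v i].
Proof. by rewrite -cone_genE enum_set1. Qed.

Section Coordinates.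
Variables (A : set V) (duals : seq 'Hom(V, R^o)).
Let L := zspan A.
Hypothesis dualsL : forall l, l \in duals -> dual_lattice L l.
Hypothesis duals_sep : forall x, (forall l, l \in duals -> l x = 0) -> x = 0.
Variables (F : {set K}) (u : K -> 'Hom(V, R^o)).
Hypothesis vL : forall i, i \in F -> L (v i).
Hypothesis uL : forall i, i \in F -> dual_lattice L (u i).
Hypothesis uv : forall i j, i \in F -> j \in F -> u i (v j) = (i == j)%:R.

Lemma coord_sum G (c : K -> R) i : G \subset F -> i \in F ->
  u i (\sum_(j in G) c j *: v j) = (i \in G)%:R * c i.
Proof.
move=> /subsetP GF iF; rewrite linear_sum; have [iG|iG] /= := boolP (i \in G); last first.
  rewrite mul0r big1 // => j jG; rewrite linearZ /= uv ?(GF j) //.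
  by rewrite (_ : i == j = false) ?scaler0 //; apply: contraNF iG => /eqP->.
rewrite (bigD1 i) //= linearZ /= uv // eqxx big1 ?addr0 => [|j /andP[jG ji]].
  by rewrite mul1r /GRing.scale /= mulr1.
by rewrite linearZ /= uv ?(GF j) // eq_sym (negPf ji) scaler0.
Qed.

(** Equations of the span of the [v i]: every functional vanishing on all of
    them is a combination of these. *)
Let eqs := map (fun l : 'Hom(V, R^o) => l - \sum_(i in F) l (v i) *: u i) duals.
Let ineqs G := [seq u i | i <- enum G].

Lemma eqs_dual f : f \in eqs -> dual_lattice L f.
Proof.
case/mapP=> l lD -> x Lx; rewrite add_lfunE opp_lfunE sum_lfunE.
apply: rpredB; first exact: dualsL.
apply: rpred_sum => i iF; rewrite scale_lfunE; apply: rpredM.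
  by apply: dualsL => //; apply: vL.
exact: uL.
Qed.

Lemma ineqs_dual G f : G \subset F -> f \in ineqs G -> dual_lattice L f.
Proof. by move=> /subsetP GF /mapP[i]; rewrite mem_enum => /GF iF ->; apply: uL. Qed.

Lemma eqsP x : (forall f, f \in eqs -> f x = 0) <-> x = \sum_(i in F) u i x *: v i.
Proof.
have eqsE (l : 'Hom(V, R^o)) : l x - \sum_(i in F) l (v i) * u i x =
    l (x - \sum_(i in F) u i x *: v i).
  have lS : l (\sum_(i in F) u i x *: v i) = \sum_(i in F) l (v i) * u i x.
    by rewrite linear_sum; apply: eq_bigr => i _; rewrite linearZ mulrC.
  by rewrite linearB /= lS.
have evalE (l : 'Hom(V, R^o)) : (l - \sum_(i in F) l (v i) *: u i) x =
    l x - \sum_(i in F) l (v i) * u i x.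
  rewrite add_lfunE opp_lfunE sum_lfunE.
  by under eq_bigr do rewrite scale_lfunE.
split=> [H|e f /mapP[l lD ->]]; last by rewrite evalE eqsE -e subrr linear0.
apply/eqP; rewrite -subr_eq0; apply/eqP/duals_sep => l lD.
by rewrite -eqsE -evalE H //; apply: map_f.
Qed.

Lemma cone_halfspaces G : G \subset F ->
  cone G = halfspaces_inter (eqs ++ ineqs (F :\: G)%SET) (ineqs F).
Proof.
move=> GF; apply/seteqP; split=> [x [c c0 ->]|x [Hf Hg]].
  have co i : i \in F -> u i (\sum_(j in G) c j *: v j) = (i \in G)%:R * c i.
    exact: coord_sum.
  split=> f.
    rewrite mem_cat => /orP[|/mapP[i]]; last first.
      by rewrite mem_enum => /setDP[iF iG] ->; rewrite co // (negPf iG) mul0r.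
    move: f; apply/eqsP; rewrite [RHS](big_setID G) /= (setIidPr GF).
    rewrite [X in _ + X]big1 ?addr0 => [|i /setDP[iF iG]]; last first.
      by rewrite co // (negPf iG) mul0r scale0r.
    by apply: eq_bigr => i iG; rewrite co ?(subsetP GF) // iG mul1r.
  move=> /mapP[i]; rewrite mem_enum => iF ->; rewrite co //.
  by case: (boolP (i \in G)) => iG; rewrite ?mul0r // mul1r c0.
have xE : x = \sum_(i in F) u i x *: v i.
  by apply/eqsP => f fe; apply: Hf; rewrite mem_cat fe.
exists (fun i => u i x) => [i iG|].
  by apply: Hg; apply/map_f; rewrite mem_enum (subsetP GF).
rewrite {1}xE (big_setID G) /= (setIidPr GF) [X in _ + X]big1 ?addr0 // => i iFG.
by rewrite Hf ?scale0r // mem_cat; apply/orP; right; apply: map_f; rewrite mem_enum.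
Qed.

Lemma cone_face G : G \subset F -> is_face L (cone G) (cone F).
Proof.
move=> GF; have e : eqs = eqs ++ ineqs (F :\: F)%SET by rewrite setDv /ineqs enum_set0 cats0.
exists eqs, (ineqs F), (ineqs (F :\: G)%SET); split.
- by move=> f; apply: eqs_dual.
- by move=> f; apply: ineqs_dual.
- by move=> f /mapP[i]; rewrite mem_enum => /setDP[iF _] ->; apply: map_f; rewrite mem_enum.
- by rewrite {1}e; apply: cone_halfspaces.
- exact: cone_halfspaces.
Qed.

Lemma cone_is_cone : is_cone L (cone F).
Proof.
exists (eqs ++ ineqs (F :\: F)%SET), (ineqs F); split.
- by move=> f /=; rewrite mem_cat => /orP[/eqs_dual//|/mapP[i]]; rewrite setDv enum_set0.
- by move=> f; apply: ineqs_dual.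
- exact: cone_halfspaces.
Qed.

Lemma free_cone (s : seq K) : uniq s -> {subset s <= F} -> free [seq v i | i <- s].
Proof.
elim: s => [|i s IH] /=; first by rewrite nil_free.
move=> /andP[si us] sF; rewrite free_cons IH ?andbT // => [|j js]; last first.
  by apply: sF; rewrite inE js orbT.
have iF : i \in F by apply: sF; rewrite mem_head.
suff /subvP H : (<<[seq v j | j <- s]>> <= lker (u i))%VS.
  by apply/negP=> /H; rewrite memv_ker uv // eqxx oner_eq0.
apply/span_subvP => _ /mapP[j js ->]; rewrite memv_ker uv //.
  by rewrite (_ : i == j = false) //; apply: contraNF si => /eqP->.
by apply: sF; rewrite inE js orbT.
Qed.

Lemma linspan_cone : linspan (cone F) = <<[seq v i | i <- enum F]>>%VS.
Proof.
have [sub lub] := linspanP (cone F); apply: subv_anti; apply/andP; split.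
  apply: lub => _ [c c0 ->]; apply: memv_suml => i iF; apply: memvZ.
  by apply/memv_span/map_f; rewrite mem_enum.
by apply/span_subvP => _ /mapP[i iF ->]; apply/sub/mem_cone; rewrite -mem_enum.
Qed.

Lemma cdim_cone : cdim (cone F) = #|F|.
Proof.
rewrite /cdim linspan_cone; have : free [seq v i | i <- enum F].
  by apply: free_cone; [exact: enum_uniq | move=> i; rewrite mem_enum].
by rewrite /free => /eqP->; rewrite size_map -cardE.
Qed.

Lemma cone_simplicial : simplicial (cone F).
Proof.
exists [seq v i | i <- enum F]; first by rewrite size_map -cardE cdim_cone.
by rewrite cone_genE.
Qed.

Lemma linspan_coneP x : x \in linspan (cone F) <-> x = \sum_(i in F) u i x *: v i.
Proof.
rewrite linspan_cone; split=> [|->]; last first.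
  by apply: memv_suml => i iF; apply/memvZ/memv_span/map_f; rewrite mem_enum.
rewrite span_def big_map big_enum => /memv_sumP[w wv ->].
have wE i : i \in F -> w i = u i (w i) *: v i.
  by move=> iF; have /vlineP[k ->] := wv i iF; rewrite linearZ /= uv // eqxx /GRing.scale /= mulr1.
have -> : \sum_(i in F) w i = \sum_(i in F) u i (w i) *: v i by apply: eq_bigr.
by apply: eq_bigr => i iF; rewrite coord_sum // iF mul1r.
Qed.

Lemma sublattice_cone : sublattice L (cone F) = zspan (v @` [set` F]).
Proof.
apply/seteqP; split=> x.
  case=> /= /linspan_coneP xE Lx; rewrite xE; apply: zspan_sum => i iF.
  have /intrP[k ->] : u i x \is a Num.int by apply: uL.
  by rewrite scaler_int; apply/zspanMz/zspan_gen; exists i.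
move=> Lx; split; last first.
  by apply: zspan_sub Lx => _ [i iF <-]; apply: vL.
case: Lx => s sF ->; rewrite /= big_seq; apply: memv_suml => p /sF[i iF <-].
by rewrite -scaler_int; apply: memvZ; apply: (proj1 (linspanP (cone F))); apply: mem_cone.
Qed.

(** A functional that is nonnegative on a simplicial cone vanishes at a point
    of it only if it vanishes on all the generators that occur at that point. *)
Lemma face_cone C : is_face L C (cone F) -> exists2 G : {set K}, G \subset F & C = cone G.
Proof.
move=> [fs [gs [gs' [_ _ sub eF ->]]]].
pose G := [set i in F | all (fun g : 'Hom(V, R^o) => g (v i) == 0) gs']%SET.
have GF : G \subset F by apply/subsetP => i; rewrite inE => /andP[].
have vF i : i \in F -> halfspaces_inter fs gs (v i) by rewrite -eF; apply: mem_cone.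
exists G => //; apply/seteqP; split=> x [].
  move=> xf xg; have : halfspaces_inter fs gs x.
    by split=> // f ff; apply: xf; rewrite mem_cat ff.
  rewrite -eF => -[c c0 xE]; exists c => [i iG|]; first by apply/c0/(subsetP GF).
  rewrite {1}xE (big_setID G) /= (setIidPr GF) [X in _ + X]big1 ?addr0 // => i /setDP[iF].
  rewrite inE iF /= => /allPn[g gg' gv].
  have gx : g x = 0 by apply: xf; rewrite mem_cat gg' orbT.
  suff /eqP : c i * g (v i) = 0.
    by rewrite mulf_eq0 (negPf gv) orbF => /eqP->; rewrite scale0r.
  move: gx; rewrite xE linear_sum => /eqP; rewrite psumr_eq0 => [/allP/(_ i)|j jF].
    by rewrite mem_index_enum iF linearZ => /(_ isT)/eqP.
  rewrite linearZ; apply: mulr_ge0; first exact: c0.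
  by have [_] := vF j jF; apply; apply: sub.
move=> c c0 ->; have xF : cone F (\sum_(i in G) c i *: v i).
  exists (fun i => (i \in G)%:R * c i) => [i _|].
    by case: (boolP (i \in G)) => iG; rewrite ?mul0r // mul1r c0.
  rewrite [RHS](big_setID G) /= (setIidPr GF) [X in _ + X]big1 ?addr0 => [|i /setDP[_ iG]].
    by apply: eq_bigr => i ->; rewrite mul1r.
  by rewrite (negPf iG) mul0r scale0r.
rewrite eF in xF; case: xF => xf xg; split=> // f; rewrite mem_cat => /orP[/xf//|fg].
rewrite linear_sum big1 // => i; rewrite inE => /andP[_ /allP/(_ _ fg)/eqP fv].
by rewrite linearZ /= fv scaler0.
Qed.

End Coordinates.
End UnimodularCones.

(** * Hierarchies of clusters *)

Section Hierarchies.
Local Open Scope nat_scope.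
Variables (n : nat) (r : 'I_n).
Implicit Types (I J K X : {set 'I_n}) (F : {set {set 'I_n}}) (i j : 'I_n).

(** The side of a split that avoids [r]: removing a bounded edge of a tree leaves
    at least two ends on both sides, and [r] is on the other one. *)
Definition cluster I := [&& r \notin I, 1 < #|I| & #|I| < n.-1].

Definition nested I J := [|| I \subset J, J \subset I | [disjoint I & J]].

Definition hierarchy F :=
  {in F, forall I, cluster I} /\ {in F &, forall I J, nested I J}.

Definition top : {set 'I_n} := [set~ r].

Lemma card_top : #|top| = n.-1.
Proof. by rewrite cardsC1 card_ord. Qed.

Lemma nestedC I J : nested I J = nested J I.
Proof. by rewrite /nested orbCA disjoint_sym. Qed.

Lemma nested_meet I J i : nested I J -> i \in I -> i \in J ->
  (I \subset J) || (J \subset I).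
Proof.
by case/or3P=> [->|->|/disjointFr IJ iI]; rewrite ?orbT // IJ.
Qed.

Lemma cluster_proper_top I : cluster I -> I \proper top.
Proof.
case/and3P=> rI _ In; rewrite properEcard card_top In andbT.
by apply/subsetP=> i iI; rewrite !inE; apply: contraNneq rI => <-.
Qed.

Lemma subset_hierarchy F (G : {set {set 'I_n}}) : G \subset F -> hierarchy F -> hierarchy G.
Proof.
by move=> /subsetP GF [cF nF]; split=> [I|I J] /GF IF; [apply: cF|move/GF; apply: nF].
Qed.

(** In the tree of [F], this is the vertex above [X]. The alternative [J == top]
    makes [top] its own parent. *)
Definition par F X : {set 'I_n} :=
  [arg min_(J < top | (J \in top |: F) && ((X \proper J) || (J == top))) #|J|].

(** The single leaves take the place of the ends other than [r], so that every
    member of [top |: F] is the disjoint union of its children. *)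
Definition tree_nodes F := (top |: F) :|: [set [set i] | i in top].

Definition children F J :=
  [set K in tree_nodes F | (K != top) && (par F K == J)].

Lemma par_node F X : par F X \in top |: F.
Proof. by rewrite /par; case: arg_minnP => [|J /andP[]//]; rewrite setU11 eqxx orbT. Qed.

Lemma proper_par F X : X \proper top -> X \proper par F X.
Proof.
move=> Xt; rewrite /par; case: arg_minnP => [|J /andP[_ /orP[//|/eqP->//]] _].
by rewrite setU11 eqxx orbT.
Qed.

Lemma par_top F : par F top = top.
Proof.
rewrite /par; case: arg_minnP => [|J /andP[_ /orP[tJ|/eqP//]] /(_ top)].
  by rewrite setU11 eqxx orbT.
by rewrite setU11 eqxx orbT leqNgt proper_card // => /(_ isT).
Qed.

Section FixedHierarchy.
Variable F : {set {set 'I_n}}.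
Hypotheses (hn : 2 < n) (hF : hierarchy F).

Lemma node_subset_top J : J \in top |: F -> J \subset top.
Proof. by case/setU1P=> [->//|/(proj1 hF)/cluster_proper_top/proper_sub]. Qed.

Lemma node_neq_top J : J \in top |: F -> J != top -> J \in F.
Proof. by case/setU1P=> [->|//]; rewrite eqxx. Qed.

Lemma card_node J : J \in top |: F -> 1 < #|J|.
Proof.
case/setU1P=> [->|/(proj1 hF)/and3P[]//]; rewrite card_top; lia.
Qed.

Lemma node_nested J K : J \in top |: F -> K \in top |: F -> nested J K.
Proof.
move=> Jn Kn; case/setU1P: (Jn) => [->|JF].
  by rewrite /nested (node_subset_top Kn) orbT.
case/setU1P: (Kn) => [->|KF]; first by rewrite /nested (node_subset_top Jn).
exact: (proj2 hF).
Qed.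

Lemma par_min X J : X != set0 -> J \in top |: F -> X \proper J -> par F X \subset J.
Proof.
move=> /set0Pn[i iX] Jn XJ; rewrite /par; case: arg_minnP; first by rewrite setU11 eqxx orbT.
move=> P /andP[Pn /orP[XP|/eqP->]] Pmin.
  have := nested_meet (node_nested Pn Jn) (subsetP (proper_sub XP) _ iX)
    (subsetP (proper_sub XJ) _ iX).
  case/orP=> // JP; have := Pmin J; rewrite Jn XJ => /(_ isT) PJ.
  by have /eqP-> : J == P by rewrite eqEcard JP.
have := Pmin J; rewrite Jn XJ card_top => /(_ isT) PJ.
by have /eqP<- : J == top by rewrite eqEcard node_subset_top // card_top.
Qed.

Lemma tree_node_neq0 X : X \in tree_nodes F -> X != set0.
Proof.
case/setUP=> [/card_node|/imsetP[i _ ->]]; rewrite -card_gt0 ?cards1 //; exact: ltnW.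
Qed.

Lemma tree_node_proper_top X : X \in tree_nodes F -> X != top -> X \proper top.
Proof.
case/setUP=> [Xn Xt|/imsetP[i it ->] it']; rewrite properEneq ?Xt ?it' /=.
  exact: node_subset_top.
by rewrite sub1set.
Qed.

Lemma tree_node_nested X J : X \in tree_nodes F -> J \in top |: F -> nested X J.
Proof.
case/setUP=> [|/imsetP[i _ ->] _]; first exact: node_nested.
by rewrite /nested sub1set disjoints1; case: (i \in J); rewrite ?orbT.
Qed.

Lemma proper_tree_node X K : X \in tree_nodes F -> K \in tree_nodes F ->
  X \proper K -> K \in top |: F.
Proof.
move=> /tree_node_neq0; rewrite -card_gt0 => X0.
case/setUP=> [//|/imsetP[i _ ->] /proper_card].
by rewrite cards1; case: #|X| X0.
Qed.

Lemma child_proper J K : K \in children F J -> K \proper J.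
Proof.
by rewrite inE => /and3P[Kn Kt /eqP<-]; apply/proper_par/tree_node_proper_top.
Qed.

Lemma child_tree_node J K : K \in children F J -> K \in tree_nodes F.
Proof. by rewrite inE => /and3P[]. Qed.

Lemma child_neq0 J K : K \in children F J -> K != set0.
Proof. by move/child_tree_node/tree_node_neq0. Qed.

(** A largest tree node between [X] and [J] is a child of [J]. *)
Lemma subset_child J X : J \in top |: F -> X \in tree_nodes F -> X \proper J ->
  exists2 K, K \in children F J & X \subset K.
Proof.
move=> Jn Xn XJ.
pose P K := [&& K \in tree_nodes F, X \subset K & K \proper J].
have PX : P X by rewrite /P Xn XJ subxx.
case: (arg_maxnP (fun K : {set 'I_n} => #|K|) PX) => K /and3P[Kn XK KJ] Kmax.
exists K => //; have Kt : K \proper top := proper_sub_trans KJ (node_subset_top Jn).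
rewrite inE Kn proper_neq //=.
have parJ : par F K \subset J by rewrite par_min // (tree_node_neq0 Kn).
apply: contraT => neqJ; have := Kmax (par F K).
rewrite /P inE par_node properEneq neqJ parJ.
rewrite (subset_trans XK (proper_sub (proper_par _ Kt))) => /(_ isT).
by rewrite /= leqNgt proper_card // proper_par.
Qed.

Lemma mem_child J i : J \in top |: F -> i \in J ->
  exists2 K, K \in children F J & i \in K.
Proof.
move=> Jn iJ; have it := subsetP (node_subset_top Jn) _ iJ.
have iJ' : [set i] \proper J by rewrite properEcard sub1set iJ cards1 card_node.
have [|K KJ] := @subset_child J [set i] Jn _ iJ'; last by rewrite sub1set; exists K.
by rewrite inE imset_f ?orbT.
Qed.

Lemma child_sub_eq J K L : K \in children F J -> L \in children F J ->
  K \subset L -> K = L.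
Proof.
move=> KJ LJ; rewrite subEproper => /predU1P[//|KL].
have Ln : L \in top |: F.
  by apply: proper_tree_node KL; apply: (@child_tree_node J).
have := par_min (child_neq0 KJ) Ln KL.
move: KJ; rewrite inE => /and3P[_ _ /eqP->] JL.
by have := proper_sub_trans (child_proper LJ) JL; rewrite properxx.
Qed.

Lemma child_meet_eq J K L i : K \in children F J -> L \in children F J ->
  i \in K -> i \in L -> K = L.
Proof.
move=> KJ LJ iK iL.
have KLn : nested K L.
  move: (child_tree_node KJ) (child_tree_node LJ) => Kn /setUP[Ln|/imsetP[j _ Lj]].
    exact: tree_node_nested.
  by move: iL; rewrite /nested Lj !sub1set inE => /eqP<-; rewrite iK orbT.
case/orP: (nested_meet KLn iK iL) => KL; first exact: child_sub_eq KJ LJ KL.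
exact/esym/(child_sub_eq LJ KJ KL).
Qed.

Lemma two_children J : J \in top |: F ->
  exists a b K L, [/\ K \in children F J, L \in children F J, a \in K, b \in L
    & b \notin K].
Proof.
move=> Jn; have /set0Pn[a aJ] : J != set0.
  by apply: (@tree_node_neq0 J); rewrite inE Jn.
have [K KJ aK] := mem_child Jn aJ; have /properP[_ [b bJ bK]] := child_proper KJ.
by have [L LJ bL] := mem_child Jn bJ; exists a, b, K, L.
Qed.

Lemma card_children_ge2 J : J \in top |: F -> 1 < #|children F J|.
Proof.
case/two_children=> a [b [K [L [KJ LJ aK bL bK]]]].
have KL : K != L by apply: contraNneq bK => ->.
have <- : #|[set K; L]| = 2 by rewrite cards2 KL.
by apply/subset_leq_card/subsetP=> M /set2P[]->.
Qed.

Lemma top_notin : top \notin F.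
Proof. by apply/negP=> /(proj1 hF)/and3P[_ _]; rewrite card_top ltnn. Qed.

(** Every tree node but [top] is a child of exactly one node, and there are
    [#|F|] clusters and [n - 1] single leaves. *)
Lemma sum_card_children :
  \sum_(J in top |: F) #|children F J| = #|F| + n.-1.
Proof.
have -> : #|F| + n.-1 = #|tree_nodes F :\ top|.
  have -> : tree_nodes F :\ top = F :|: [set [set i] | i in top].
    rewrite /tree_nodes setDUl setU1K ?top_notin //; congr (_ :|: _).
    apply/setDidPl/pred0P=> X /=; apply/andP=> -[/imsetP[i _ ->]].
    by rewrite inE => /eqP/(congr1 (fun A : {set _} => #|A|)); rewrite cards1 card_top; lia.
  rewrite cardsU card_imset; last exact: set1_inj.
  rewrite card_top (_ : F :&: _ = set0) ?cards0 ?subn0 //.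
  apply/setP=> X; rewrite !inE; apply/andP=> -[/(proj1 hF)/and3P[_ X1 _]] /imsetP[i _ eX].
  by rewrite eX cards1 in X1.
rewrite -sum1_card [RHS](partition_big (par F) (mem (top |: F))) /=; last first.
  by move=> X _; rewrite par_node.
apply: eq_bigr=> J _; rewrite -sum1_card; apply: eq_bigl=> K.
by rewrite in_setD1 [in LHS]inE -andbA andbCA.
Qed.

(** The [#|F| + 1] nodes have at least two children each and [#|F| + n - 1]
    children in total, which leaves [n - 3 - #|F|] children to distribute. *)
Lemma sum_excess : \sum_(J in top |: F) (#|children F J| - 2) + #|F| = n - 3.
Proof.
have := sum_card_children.
have -> : \sum_(J in top |: F) #|children F J| =
    \sum_(J in top |: F) (#|children F J| - 2) + \sum_(J in top |: F) 2.
  by rewrite -big_split; apply: eq_bigr=> J Jn /=; rewrite subnK // card_children_ge2.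
rewrite sum_nat_const cardsU1 top_notin add1n.
move: (\sum_(J in top |: F) (#|children F J| - 2)) #|F| => s f; lia.
Qed.

Lemma card_hierarchy : #|F| <= n - 3.
Proof. by rewrite -sum_excess leq_addl. Qed.

Lemma exists_ternary : #|F| < n - 3 ->
  exists2 J, J \in top |: F & 2 < #|children F J|.
Proof.
rewrite -sum_excess -[X in X < _]add0n ltn_add2r => S0.
have /existsP[J] : [exists J, (J \in top |: F) && (2 < #|children F J|)].
  apply: contraTT S0; rewrite negb_exists => /forallP H; rewrite -leqNgt leqn0.
  rewrite big1 // => J Jn; have := H J; rewrite Jn /=; lia.
by case/andP; exists J.
Qed.

Lemma unique_ternary J : #|F|.+1 = n - 3 -> J \in top |: F -> 2 < #|children F J| ->
  #|children F J| = 3 /\ forall K, K \in top |: F -> 2 < #|children F K| -> K = J.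
Proof.
move=> cF Jn J3; have S0 := sum_excess.
have : \sum_(K in top |: F) (#|children F K| - 2) = 1.
  by apply/eqP; rewrite -(eqn_add2r #|F|) S0 -cF add1n.
rewrite (bigD1 J) //= => S1; split.
  by move: S1 J3; move: #|children F J| => c; lia.
move=> K Kn K3; apply/eqP/contraT=> KJ.
move: S1; rewrite (bigD1 K) ?Kn //= => S1.
by move: S1 J3 K3; move: #|children F J| #|children F K| => c d; lia.
Qed.

(** A cluster strictly inside [J] lies in a single child, so it is nested with
    the union of the other children, and differs from it as that union meets at
    least two children. *)
Lemma cut_child J K : J \in top |: F -> 2 < #|children F J| -> K \in children F J ->
  hierarchy ((J :\: K) |: F) /\ J :\: K \notin F.
Proof.
move=> Jn J3 KJ.
have [L [M [LJ MJ [LK MK LM]]]] : exists L M, [/\ L \in children F J, M \in children F J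
    & [/\ L != K, M != K & L != M]].
  have : 1 < #|children F J :\ K| by move: J3; rewrite (cardsD1 K) KJ.
  case/card_gt1P=> L [M [/setD1P[LK LJ] /setD1P[MK MJ] LM]]; by exists L, M.
have sub_cut L' : L' \in children F J -> L' != K -> L' \subset J :\: K.
  move=> LJ' LK'; apply/subsetP=> i iL; rewrite !inE (subsetP (proper_sub (child_proper LJ'))) // andbT.
  by apply: contraNN LK' => iK; apply/eqP/(child_meet_eq LJ' KJ iL iK).
have Jt := node_subset_top Jn.
have [i iL] := set0Pn _ (child_neq0 LJ); have [j jM] := set0Pn _ (child_neq0 MJ).
have ij : i != j.
  by apply: contraNneq LM => eij; apply/eqP/(child_meet_eq LJ MJ iL); rewrite eij.
have cut_proper : J :\: K \proper J.
  apply/properP; split; first exact: subsetDl.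
  have [k kK] := set0Pn _ (child_neq0 KJ).
  by exists k; rewrite ?inE ?kK // (subsetP (proper_sub (child_proper KJ))).
have cc : cluster (J :\: K).
  apply/and3P; split.
  - rewrite inE negb_and; apply/orP; right.
    by apply/negP=> /(subsetP Jt); rewrite !inE eqxx.
  - have <- : #|[set i; j]| = 2 by rewrite cards2 ij.
    apply/subset_leq_card/subsetP=> k /set2P[->|->].
      exact: (subsetP (sub_cut L LJ LK)).
    exact: (subsetP (sub_cut M MJ MK)).
  - by rewrite -card_top; apply: proper_card; apply: proper_sub_trans Jt.
have cn I : I \in F -> nested (J :\: K) I.
  move=> IF; have In : I \in top |: F by rewrite inE IF orbT.
  case/or3P: (node_nested Jn In) => [JI|IJ|dJI].
  - by rewrite /nested (subset_trans (proper_sub cut_proper) JI).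
  - move: IJ; rewrite subEproper => /predU1P[->|IJ]; first by rewrite /nested subsetDl.
    have [|K' KJ' IK'] := @subset_child J I Jn _ IJ; first by rewrite inE In.
    have [eK|/(sub_cut _ KJ') K'c] := eqVneq K' K.
      rewrite /nested; apply/or3P/Or33; rewrite disjoints_subset.
      by apply/subsetP=> x; rewrite !inE => /andP[xK _]; apply: contra xK; rewrite -eK; apply: (subsetP IK').
    by rewrite /nested (subset_trans IK' K'c) orbT.
  - rewrite /nested (disjointWl _ dJI) ?orbT //; exact: subsetDl.
split; last first.
  apply/negP=> cF; have cutn : J :\: K \in tree_nodes F by rewrite !inE cF orbT.
  have [K' KJ' sK'] := subset_child Jn cutn cut_proper.
  have := child_sub_eq LJ KJ' (subset_trans (sub_cut L LJ LK) sK').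
  have := child_sub_eq MJ KJ' (subset_trans (sub_cut M MJ MK) sK').
  by move=> eM eL; rewrite eL eM eqxx in LM.
split=> [I|I I'].
  by case/setU1P=> [->//|/(proj1 hF)].
case/setU1P=> [->|IF] /setU1P[->|I'F]; first by rewrite /nested subxx.
- exact: cn.
- by rewrite nestedC cn.
- exact: (proj2 hF).
Qed.

(** The parent of [I] is cut into children that either lie in [I] or avoid it.
    As [I] is neither one child nor all of them, with at most three children it
    consists of two out of three. *)
Lemma refinement_cut I : hierarchy (I |: F) -> I \notin F ->
  #|children F (par F I)| <= 3 ->
  2 < #|children F (par F I)| /\
  exists2 K, K \in children F (par F I) & I = par F I :\: K.
Proof.
move=> [cIF nIF] IF; set J := par F I => J3.
have cI := cIF I (setU11 _ _); have It := cluster_proper_top cI.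
have I0 : I != set0 by rewrite -card_gt0; case/and3P: cI => _ /ltnW.
have Jn : J \in top |: F := par_node F I.
have IJ : I \proper J := proper_par F It.
have not_sub K : K \in children F J -> ~~ (I \subset K).
  move=> KJ; apply/negP=> IK; have Kn : K \in top |: F.
    case/setUP: (child_tree_node KJ) => [//|/imsetP[k _ eK]].
    move/subset_leq_card: IK; rewrite eK cards1 leqNgt; by case/and3P: cI => _ ->.
  have IK' : I \proper K.
    rewrite properEneq IK andbT; apply: contraNneq IF => eI; move: Kn; rewrite -eI.
    by case/setU1P=> [eIt|//]; rewrite eIt properxx in It.
  have := proper_sub_trans (child_proper KJ) (par_min I0 Kn IK').
  by rewrite properxx.
have child_alt K i : K \in children F J -> i \in K -> i \in I -> K \subset I.
  move=> KJ iK iI; have IKn : nested K I.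
    case/setUP: (child_tree_node KJ) => [Kn|/imsetP[k _ eK]].
      case/setU1P: Kn => [->|KF]; last by apply: nIF; rewrite ?setU11 // inE KF orbT.
      by rewrite /nested (proper_sub It) orbT.
    by rewrite /nested eK sub1set; move: iK; rewrite eK inE => /eqP<-; rewrite iI.
  by have := nested_meet IKn iK iI; rewrite (negPf (not_sub K KJ)) orbF.
have /properP[IJs [j jJ jI]] := IJ.
have [K KJ jK] := mem_child Jn jJ.
have KI i : i \in I -> i \notin K.
  by move=> iI; apply: contra jI => iK; apply: (subsetP (child_alt K i KJ iK iI)).
(* Two children missing I would leave I inside a single third one. *)
have no_two L : L \in children F J -> L != K -> {in I, forall i, i \notin L} ->
    #|children F J :\ K :\ L| <= 1 -> False.
  move=> LJ LK IL c1; have [i iI] := set0Pn _ I0.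
  have [M MJ iM] := mem_child Jn (subsetP IJs _ iI).
  have other M' k : M' \in children F J -> k \in I -> k \in M' ->
      M' \in children F J :\ K :\ L.
    move=> MJ' kI kM'; rewrite in_setD1 in_setD1 MJ' andbT; apply/andP; split.
      by apply: contraTneq kM' => ->; apply: IL.
    by apply: contraTneq kM' => ->; apply: KI.
  suff : I \subset M by rewrite (negPf (not_sub _ MJ)).
  apply/subsetP=> k kI; have [M' MJ' kM'] := mem_child Jn (subsetP IJs _ kI).
  by rewrite (card_le1_eqP c1 M' M) ?(other M i) ?(other M' k).
have c2 : #|children F J :\ K| = #|children F J|.-1 by rewrite [in RHS](cardsD1 K) KJ.
split.
  rewrite ltnNge; apply/negP=> le2; have [i iI] := set0Pn _ I0.
  have [M MJ iM] := mem_child Jn (subsetP IJs _ iI).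
  have MK : M != K by apply: contraTneq iM => ->; apply: KI.
  suff : I \subset M by rewrite (negPf (not_sub _ MJ)).
  apply/subsetP=> k kI; have [M' MJ' kM'] := mem_child Jn (subsetP IJs _ kI).
  have MK' : M' != K by apply: contraTneq kM' => ->; apply: KI.
  have c1 : #|children F J :\ K| <= 1 by rewrite c2; move: le2; case: #|_| => [|[|[]]].
  by rewrite (card_le1_eqP c1 M' M) ?in_setD1 ?MJ ?MK ?MJ' ?MK'.
exists K => //; apply/eqP; rewrite eqEsubset; apply/andP; split.
  by apply/subsetP=> i iI; rewrite inE KI // (subsetP IJs).
apply/subsetP=> i; rewrite inE => /andP[iK iJ]; apply: contraT => iI.
have [L LJ iL] := mem_child Jn iJ.
have LK : L != K by apply: contraNneq iK => <-.
case: (no_two L LJ LK) => [k kI|].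
  by apply: contra iI => kL; apply: (subsetP (child_alt L k LJ kL kI)).
have : #|children F J :\ K| <= 2 by rewrite c2; move: J3; case: #|_|.
by rewrite (cardsD1 L) in_setD1 LJ LK.
Qed.

(** [a] and [b] lie in different children of [I], and [c] in its parent but not
    in [I]: the quartet ab|cr is displayed by the edge [I] only. *)
Lemma dual_triple I : I \in F -> exists a b c,
  [/\ a != b, a != c, [&& r != a, r != b & r != c] & {in F, forall J,
      (([set a; b] \subset J) = (I \subset J)) /\
      (([set a; c] \subset J) = (I \proper J))}].
Proof.
move=> IF; have In : I \in top |: F by rewrite inE IF orbT.
have cI := proj1 hF I IF; have It := cluster_proper_top cI.
have [a [b [K [L [KI LI aK bL bK]]]]] := two_children In.
have /properP[IP [c cP cI']] := proper_par F It.
have aI := subsetP (proper_sub (child_proper KI)) _ aK.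
have bI := subsetP (proper_sub (child_proper LI)) _ bL.
have topP i : i \in top -> r != i by rewrite !inE eq_sym.
exists a, b, c; split.
- by apply: contraNneq bK => <-.
- by apply: contraNneq cI' => <-.
- have ct := subsetP (node_subset_top (par_node F I)) _ cP.
  by rewrite !topP // (subsetP (proper_sub It)).
move=> J JF; rewrite !subUset !sub1set; split; apply/idP/idP.
- case/andP=> aJ bJ; have := nested_meet (proj2 hF _ _ IF JF) aI aJ.
  case/orP=> //; rewrite subEproper => /predU1P[->//|JI].
  have [|M MI JM] := @subset_child I J In _ JI; first by rewrite !inE JF orbT.
  have eK := child_meet_eq KI MI aK (subsetP JM _ aJ).
  by rewrite eK (subsetP JM) in bK.
- by move=> IJ; rewrite !(subsetP IJ).
- case/andP=> aJ cJ; rewrite properE; case/orP: (nested_meet (proj2 hF _ _ IF JF) aI aJ).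
    by move=> ->; apply: contra cI' => /subsetP; apply.
  by move/subsetP/(_ _ cJ); rewrite (negPf cI').
- move=> IJ; rewrite (subsetP (proper_sub IJ)) //=.
  have JN : J \in top |: F by rewrite inE JF orbT.
  apply: (subsetP (par_min _ JN IJ)) => //; apply/set0Pn; by exists a.
Qed.

(** A hierarchy is determined by its rooted triples ab|c: intersecting, over
    all [c] outside [I], the largest members of [F] that contain [a] but not
    [c], yields [I]. *)
Lemma mem_hierarchy_triples I : cluster I ->
  (forall a b c, a \in I -> b \in I -> a != b -> c \in top -> c \notin I ->
    exists2 J, J \in F & [/\ a \in J, b \in J & c \notin J]) -> I \in F.
Proof.
move=> cI H; apply: contraT => IF; have It := cluster_proper_top cI.
have /properP[IP [c cP cI']] := proper_par F It.
have ct := subsetP (node_subset_top (par_node F I)) _ cP.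
have /and3P[_ /card_gt1P[a [b [aI bI ab]]] _] := cI.
have [J0 J0F [aJ0 bJ0 cJ0]] := H a b c aI bI ab ct cI'.
pose P J := [&& J \in F, a \in J & c \notin J].
have PJ0 : P J0 by rewrite /P J0F aJ0.
case: (arg_maxnP (fun K : {set 'I_n} => #|K|) PJ0) => J /and3P[JF aJ cJ] Jmax.
have IJ : I \subset J.
  apply/subsetP=> d dI; have [<-//|ad] := eqVneq a d.
  have [K KF [aK dK cK]] := H a d c aI dI ad ct cI'.
  case/orP: (nested_meet (proj2 hF _ _ KF JF) aK aJ) => [/subsetP->//|JK].
  have := Jmax K; rewrite /P KF aK => /(_ cK) KJ.
  by have /eqP-> : J == K by rewrite eqEcard JK.
case/negP: cJ; have JN : J \in top |: F by rewrite inE JF orbT.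
apply: (subsetP (par_min _ JN _)) cP; first by apply/set0Pn; exists a.
by rewrite properEneq IJ andbT; apply: contraNneq IF => ->.
Qed.

End FixedHierarchy.
End Hierarchies.

(** * Rooted trees *)

(** Two simple paths that leave [x] along different edges and meet again would
    close up to a cycle of length at least 3. *)
Lemma acyclic_simple_path_inj (V : eqType) (e : rel V) : symmetric e ->
    (forall c, cycle e c -> uniq c -> (size c <= 2)%N) ->
  forall (p q : seq V) x, path e x p -> path e x q -> uniq (x :: p) ->
    uniq (x :: q) -> last x p = last x q -> p = q.
Proof.
move=> es ea; elim=> [|a p IH] [|b q] x //=.
- move=> _ _ _ /andP[xq _] xl; by rewrite xl mem_last in xq.
- move=> _ _ /andP[xq _] _ xl; by rewrite -xl mem_last in xq.
move=> /andP[xa pa] /andP[xb pb] /andP[xp up] /andP[xq uq] l.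
have [eab|ab] := eqVneq a b.
  by rewrite -{}eab in pb uq l *; rewrite (IH q a).
pose w := p ++ rev (belast b q).
have pw : path e a w.
  rewrite cat_path pa /= l rev_path.
  by under eq_path do rewrite es.
have lw : last a w = b.
  by rewrite last_cat l /=; case: (q) => //= c q'; rewrite rev_cons last_rcons.
have xw : x \notin a :: w.
  rewrite inE mem_cat mem_rev !negb_or; move: xp; rewrite inE negb_or => /andP[-> ->] /=.
  by apply: contra xq => /mem_belast.
move: lw; case: (shortenP pw) => p' pp' up' sp' lw.
have : (size [:: x, a & p'] <= 2)%N.
  apply: ea.
    by rewrite /= rcons_path xa pp' lw es.
  rewrite /= in up' *; rewrite up' andbT; move: xw; rewrite !inE !negb_or => /andP[-> xw] /=.
  by apply: contra xw => /sp'.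
by case: p' lw {pp' up' sp'} => //= eab; rewrite eab eqxx in ab.
Qed.

Section RootedTree.
Variables (n : nat) (T : tree_type n) (r : 'I_n).
Hypothesis hn : (2 < n)%N.
Implicit Types (u v w x y : T) (i j : 'I_n).

Let root : T := end_at T r.

Lemma tree_pathP x y : simple_path x y (tree_path x y).
Proof. exact: xchooseP. Qed.

Lemma simple_path_unique x y p : simple_path x y p -> p = tree_path x y.
Proof.
move=> /and3P[xp /eqP lp up]; have /and3P[xq /eqP lq uq] := tree_pathP x y.
apply: (acyclic_simple_path_inj (@adj_sym n T) (@adj_acyclic n T) xp xq up uq).
by rewrite lp lq.
Qed.

Definition anc x v := v \in root :: tree_path root x.

Definition depth x := size (tree_path root x).

Definition parent v : T := odflt root [pick u | adj u v && anc v u].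

Lemma tree_path_refl x : tree_path x x = [::].
Proof. by apply/esym/simple_path_unique; rewrite /simple_path /= eqxx. Qed.

Lemma anc_refl x : anc x x.
Proof.
by have /and3P[_ /eqP lx _] := tree_pathP root x; rewrite /anc -{1}lx mem_last.
Qed.

Lemma anc_root x : anc x root.
Proof. exact: mem_head. Qed.

Lemma root_anc v : anc root v -> v = root.
Proof. by rewrite /anc tree_path_refl inE => /eqP. Qed.

Lemma anc_prefix x v : anc x v ->
  exists2 p, tree_path root x = tree_path root v ++ p & last v p = x.
Proof.
move=> av; have /and3P[] := tree_pathP root x; move: av; rewrite /anc.
case/splitPl=> p1 p2 lp1; rewrite cat_path last_cat lp1 => /andP[pp1 pp2] /eqP lp2.
rewrite -cat_cons cat_uniq => /andP[up1 _]; exists p2 => //; congr (_ ++ _).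
by apply: simple_path_unique; rewrite /simple_path pp1 lp1 eqxx.
Qed.

Lemma anc_trans x v u : anc x v -> anc v u -> anc x u.
Proof.
move=> /anc_prefix[p e _]; rewrite /anc e !inE => /orP[->//|vu].
by rewrite mem_cat vu orbT.
Qed.

Lemma anc_depth x v : anc x v -> (depth v <= depth x)%N.
Proof. by move=> /anc_prefix[p e _]; rewrite /depth e size_cat leq_addr. Qed.

Lemma anc_anti x v : anc x v -> anc v x -> x = v.
Proof.
move=> xv /anc_depth; have [p e l] := anc_prefix xv.
rewrite /depth e size_cat -[X in (_ <= X)%N]addn0 leq_add2l leqn0 size_eq0 => /eqP p0.
by rewrite -l p0.
Qed.

Lemma anc_total x u v : anc x u -> anc x v -> anc u v || anc v u.
Proof.
move=> xu; have [p e l] := anc_prefix xu; rewrite /anc e inE mem_cat orbA.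
rewrite -in_cons => /orP[->//|vp]; have xv : anc x v by rewrite /anc e inE mem_cat vp !orbT.
rewrite orbC; apply/orP; left; have [p' e' l'] := anc_prefix xv.
case/splitPr: vp e => p1 p2 e.
have /and3P[_ _] := tree_pathP root x; rewrite e.
have -> : tree_path root u ++ p1 ++ v :: p2 = (tree_path root u ++ rcons p1 v) ++ p2.
  by rewrite -catA cat_rcons.
move=> ux; have /and3P[px _ _] := tree_pathP root x.
have <- : tree_path root u ++ rcons p1 v = tree_path root v.
  apply: simple_path_unique; rewrite /simple_path last_cat last_rcons eqxx.
  move: px; rewrite e -cat_rcons catA cat_path => /andP[-> _] /=.
  by move: ux; rewrite -cat_cons cat_uniq => /andP[].
by have := anc_refl u; rewrite /anc -cat_cons mem_cat => ->.
Qed.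

Lemma tree_path_parent u v : adj u v -> anc v u ->
  tree_path root v = rcons (tree_path root u) v.
Proof.
move=> uv vu; have [p e l] := anc_prefix vu.
suff pE : p = [:: v] by rewrite e pE cats1.
have /and3P[pv _ uu] := tree_pathP root v; have /and3P[_ /eqP lu _] := tree_pathP root u.
apply: (acyclic_simple_path_inj (@adj_sym n T) (@adj_acyclic n T) (x := u)).
- by move: pv; rewrite e cat_path lu => /andP[].
- by rewrite /= uv.
- move: uu; rewrite e -cat_cons lastI lu -cats1 -catA cat_uniq.
  by case/and3P.
- by rewrite /= inE andbT; apply: contraTneq uv => ->; rewrite adj_irr.
- by [].
Qed.

Lemma adj_anc u v : adj u v -> anc v u || anc u v.
Proof.
move=> uv; have [_|nuv] := boolP (anc u v); first by rewrite orbT.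
rewrite orbF /anc -(_ : rcons (tree_path root u) v = tree_path root v).
  by rewrite -rcons_cons mem_rcons inE; move: (anc_refl u); rewrite /anc => ->; rewrite orbT.
have /and3P[pu /eqP lu uu] := tree_pathP root u.
apply: simple_path_unique; rewrite /simple_path rcons_path pu lu uv last_rcons eqxx.
by apply/and3P; split=> //; rewrite -rcons_cons rcons_uniq uu andbT.
Qed.

Lemma parentE u v : adj u v -> anc v u -> parent v = u.
Proof.
move=> uv vu; rewrite /parent; case: pickP => [w /andP[wv vw]|/(_ u)]; last first.
  by rewrite uv vu.
have := tree_path_parent wv vw; rewrite (tree_path_parent uv vu) => /rcons_inj[e].
have /and3P[_ /eqP <- _] := tree_pathP root u.
by have /and3P[_ /eqP <- _] := tree_pathP root w; rewrite e.
Qed.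

Lemma parent_root : parent root = root.
Proof.
rewrite /parent; case: pickP => [w /andP[wv /root_anc ew]|//].
by rewrite ew adj_irr in wv.
Qed.

Lemma parentP v : v != root -> adj (parent v) v /\ anc v (parent v).
Proof.
move=> vr; suff [u uv vu] : exists2 u, adj u v & anc v u by rewrite (parentE uv vu).
have /and3P[] := tree_pathP root v; rewrite /anc; move: (tree_path root v) => p.
case/lastP: p => [_ /= /eqP e|p w]; first by rewrite e eqxx in vr.
rewrite rcons_path last_rcons => /andP[_ lw] /eqP <- _; exists (last root p) => //.
by rewrite -rcons_cons mem_rcons inE mem_last orbT.
Qed.

Lemma parent_neq v : v != root -> parent v != v.
Proof. by move=> /parentP[a _]; apply: contraTneq a => ->; rewrite adj_irr. Qed.

Lemma depth_parent v : v != root -> depth v = (depth (parent v)).+1.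
Proof. by move=> /parentP[a b]; rewrite /depth (tree_path_parent a b) size_rcons. Qed.

Lemma anc_parentE x v : x != root -> anc x v = (v == x) || anc (parent x) v.
Proof.
move=> /parentP[a b]; rewrite /anc (tree_path_parent a b) -rcons_cons mem_rcons.
by rewrite inE.
Qed.

Lemma adjE u v : adj u v = (u != v) && ((parent u == v) || (parent v == u)).
Proof.
apply/idP/andP=> [uv|[uv /orP[/eqP e|/eqP e]]].
- split; first by apply: contraTneq uv => ->; rewrite adj_irr.
  case/orP: (adj_anc uv) => a; first by rewrite (parentE uv a) eqxx orbT.
  by rewrite adj_sym in uv; rewrite (parentE uv a) eqxx.
- have ur : u != root by apply: contraNneq uv => eu; rewrite -e eu parent_root.
  by rewrite -e adj_sym; case: (parentP ur).
- have vr : v != root by apply: contraNneq uv => eu; rewrite -e eu parent_root.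
  by rewrite -e; case: (parentP vr).
Qed.

Lemma anc_child x v : anc x v -> x != v ->
  exists w, [/\ w != root, parent w = v & anc x w].
Proof.
have [m] := ubnP (depth x); elim: m x => // m IH x dx xv nxv.
have xr : x != root by apply: contraNneq nxv => xr; rewrite xr in xv *; rewrite (root_anc xv).
move: xv; rewrite anc_parentE // eq_sym (negPf nxv) /= => pv.
have [e|ne] := eqVneq (parent x) v; first by exists x; rewrite anc_refl.
rewrite depth_parent // ltnS in dx.
have [w [wr wv xw]] := IH _ dx pv ne; exists w; split=> //.
by rewrite anc_parentE // xw orbT.
Qed.

(** * Distances as sums over separating edges *)

Section Distance.
Variables (R : realType) (len : {set T} -> R).

Definition edge_len v := len [set v; parent v]%SET.

(** The root path of the lower end [c] of an edge is that of its upper end,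
    prolonged by [c]. *)
Lemma adj_lower u v : adj u v -> exists c, [/\ c != root,
  [set u; v]%SET = [set c; parent c]%SET & forall x, anc u x (+) anc v x = (x == c)].
Proof.
wlog vu : u v / anc v u.
  move=> H uv; case/orP: (adj_anc uv) => [vu|uv']; first exact: H.
  have [|c [cr e H']] := H v u uv'; first by rewrite adj_sym.
  by exists c; rewrite setUC e; split=> // x; rewrite addbC.
move=> uv; have vr : v != root.
  by apply: contraTneq uv => vr; rewrite vr in vu *; rewrite (root_anc vu) adj_irr.
exists v; rewrite (parentE uv vu) setUC; split=> // x.
rewrite (anc_parentE _ vr) (parentE uv vu).
have [->|_] /= := eqVneq x v; last by rewrite addbb.
case: (boolP (anc u v)) => // uv'; by rewrite (anc_anti uv' vu) adj_irr in uv.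
Qed.

Lemma set2_mem (A : finType) (a b c d : A) : [set a; b]%SET = [set c; d]%SET ->
  (a == c) || (a == d).
Proof. by move=> e; have := set21 a b; rewrite e !inE. Qed.

(** The only edge that changes whether [c] is an ancestor is the one from [a] to
    [b], and a path that avoids [a] does not use it. *)
Lemma path_not_crossing a b p : adj a b -> path (@adj n T) b p -> a \notin b :: p ->
  forall c, [set a; b]%SET = [set c; parent c]%SET -> anc b c = anc (last b p) c.
Proof.
move=> ab; set A := [set a; b]%SET => pp nap c eA.
suff H q y : path (@adj n T) y q -> a \notin y :: q -> anc y c = anc (last y q) c.
  exact: H.
elim: q y {pp nap} => // z q IH y /= /andP[yz pq]; rewrite inE negb_or => /andP[ay azq].
rewrite -(IH z) //; have [d [_ e /(_ c)]] := adj_lower yz.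
have [ecd|_] := eqVneq c d; last by case: (anc y c) (anc z c) => [] [].
have : [set a; b]%SET = [set y; z]%SET by rewrite -/A eA e ecd.
move/set2_mem; rewrite (negPf ay) /= => /eqP eaz.
by rewrite eaz mem_head in azq.
Qed.

(** A simple path crosses an edge at most once, so it crosses exactly the
    edges that separate its ends. *)
Lemma tree_distE x y : tree_dist len x y =
  \sum_(v | v != root) edge_len v * (anc x v (+) anc y v)%:R.
Proof.
rewrite /tree_dist; have := tree_pathP x y; move: (tree_path x y) => p.
elim: p x => [|b p IH] x /and3P[].
  move=> _ /= /eqP -> _; rewrite big_nil big1 // => v _; by rewrite addbb mulr0.
move=> /= /andP[xb pb] lb /andP[xp up].
rewrite big_cons (IH b); last by rewrite /simple_path pb lb.
have [c [cr e H]] := adj_lower xb; rewrite e -/(edge_len c).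
rewrite (bigD1 c) //= [RHS](bigD1 c) //=; move/eqP: lb => lb.
have -> : anc b c = anc y c by rewrite -lb; apply: (path_not_crossing xb).
rewrite addbb mulr0 add0r; congr (_ + _).
  have -> : anc y c = anc b c by rewrite -lb; apply/esym/(path_not_crossing xb).
  by rewrite H eqxx mulr1.
apply: eq_bigr=> v /andP[_ vc]; congr (_ * _%:R).
by move: (H v); rewrite (negPf vc); case: (anc x v) (anc b v) => [] [].
Qed.

End Distance.

(** * The hierarchy of leaf sets *)

Definition leafset v : {set 'I_n} := [set i in top r | anc (end_at T i) v].

Lemma mem_leafset i v : i \in leafset v = (i != r) && anc (end_at T i) v.
Proof. by rewrite !inE. Qed.

(** The edge upwards, or the end [r] if [v] is the root, takes up one unit of the
    valence of [v]; at least two children or further ends remain. *)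
Lemma free_item v (A : {set T}) (B : {set 'I_n}) : (#|A| + #|B| <= 1)%N ->
  (exists y, [/\ y != root, parent y = v & y \notin A]) \/
  (exists i, [/\ i != r, end_at T i = v & i \notin B]).
Proof.
move=> AB.
pose A' := if v == root then A else (parent v |: A)%SET.
pose B' := if v == root then (r |: B)%SET else B.
have [/existsP[y /andP[vy yA]]|NA] := boolP [exists y, adj v y && (y \notin A')].
  have yA0 : y \notin A.
    by move: yA; rewrite /A'; case: eqP => // _; rewrite !inE negb_or => /andP[].
  have py : parent y = v.
    move: (vy); rewrite adjE => /andP[_ /orP[/eqP e|/eqP//]].
    move: yA; rewrite /A'; case: eqP => [ev|_]; last by rewrite !inE e eqxx.
    by move: vy; rewrite -e ev parent_root adj_irr.
  left; exists y; split=> //; apply: contraTneq vy => ey.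
  by rewrite -py ey parent_root adj_irr.
have [/existsP[i /andP[/eqP vi iB]]|NB] := boolP [exists i, (end_at T i == v) && (i \notin B')].
  right; exists i; split=> //.
    apply: contraNneq iB => ei; by rewrite /B' -vi ei eqxx setU11.
  by move: iB; rewrite /B'; case: eqP => // _; rewrite !inE negb_or => /andP[].
have := valence_ge3 v; rewrite leqNgt => /negP[]; rewrite ltnS.
have AB' : (#|A'| + #|B'| <= 2)%N.
  rewrite /A' /B'; case: eqP => _; first by rewrite cardsU1 addnCA (leq_add (leq_b1 _) AB).
  by rewrite cardsU1 -addnA (leq_add (leq_b1 _) AB).
apply: leq_trans AB'; apply: leq_add; apply/subset_leq_card/fintype.subsetP => z.
  rewrite inE => vz; move: NA; rewrite negb_exists => /forallP/(_ z).
  by rewrite vz negbK.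
rewrite inE => vz; move: NB; rewrite negb_exists => /forallP/(_ z).
by rewrite vz negbK.
Qed.

Lemma leaf_below v : exists i, i \in leafset v.
Proof.
have [m] := ubnP (#|T| - depth v); elim: m v => // m IH v dv.
have [|[y [yr yv _]]|[i [ir iv _]]] := @free_item v set0 set0; first by rewrite !cards0.
  have [|i] := IH y.
    have : (depth y < #|T|)%N.
      have /and3P[_ _ /card_uniqP c] := tree_pathP root y.
      by have := max_card (mem (root :: tree_path root y)); rewrite c.
    move: dv; rewrite (depth_parent yr) yv; clear hn; lia.
  rewrite mem_leafset => /andP[ir iy]; exists i; rewrite mem_leafset ir (anc_trans iy) //.
  by rewrite anc_parentE // yv anc_refl orbT.
by exists i; rewrite mem_leafset ir iv anc_refl.
Qed.

Lemma anc_parentF w : w != root -> anc (parent w) w = false.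
Proof.
move=> wr; apply/negP=> h; have [_ h'] := parentP wr.
by have := parent_neq wr; rewrite (anc_anti h h') eqxx.
Qed.

Lemma leaf_off_child w : w != root ->
  exists2 i, i \in leafset (parent w) & i \notin leafset w.
Proof.
move=> wr.
have [|[y [yr yv yw]]|[i [ir iv _]]] := @free_item (parent w) [set w]%SET set0.
- by rewrite cards0 cards1.
- have [i] := leaf_below y; rewrite mem_leafset => /andP[ir iy]; exists i.
    by rewrite mem_leafset ir (anc_trans iy) // anc_parentE // yv anc_refl orbT.
  rewrite mem_leafset ir /=; apply: contra yw => iw; rewrite inE.
  case/orP: (anc_total iy iw); rewrite anc_parentE // ?yv => /orP[/eqP->//|].
    by rewrite anc_parentF.
  by rewrite -yv anc_parentF.
exists i; first by rewrite mem_leafset ir iv anc_refl.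
by rewrite mem_leafset iv anc_parentF // andbF.
Qed.

Lemma second_leaf v i : i \in leafset v -> exists2 j, j \in leafset v & j != i.
Proof.
rewrite mem_leafset => /andP[ir iv]; have [e|ne] := eqVneq (end_at T i) v.
  have [|[y [yr yv _]]|[j [jr jv ji]]] := @free_item v set0 [set i]%SET.
  - by rewrite cards0 cards1.
  - have [j] := leaf_below y; rewrite mem_leafset => /andP[jr jy]; exists j.
      by rewrite mem_leafset jr (anc_trans jy) // anc_parentE // yv anc_refl orbT.
    by apply: contraTneq jy => ->; rewrite e -yv anc_parentF.
  by exists j; [rewrite mem_leafset jr jv anc_refl | rewrite inE in ji].
have [w [wr wv iw]] := anc_child iv ne.
have [j] := leaf_off_child wr; rewrite wv => jv jw; exists j => //.
by apply: contraNneq jw => ->; rewrite mem_leafset ir.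
Qed.

Lemma leafset_root : leafset root = top r.
Proof. by apply/setP=> i; rewrite inE anc_root andbT. Qed.

(** If [v] is strictly below [u], some leaf below [u] branches off from the path
    to [v]. *)
Lemma leafset_subset u v : (leafset u \subset leafset v) = anc u v.
Proof.
apply/fintype.subsetP/idP=> [H|uv i]; last first.
  by rewrite !mem_leafset => /andP[->] /anc_trans ->.
have [i iu] := leaf_below u; have iv := H _ iu.
move: (iu) (iv); rewrite !mem_leafset => /andP[_ iu'] /andP[_ iv'].
case/orP: (anc_total iu' iv') => // vu.
have [->|uv] := eqVneq v u; first exact: anc_refl.
have [w [wr wu vw]] := anc_child vu uv.
have [j] := leaf_off_child wr; rewrite wu => /H; rewrite !mem_leafset => /andP[jr jv].
by rewrite jr (anc_trans jv vw).
Qed.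

Lemma leafset_inj : injective leafset.
Proof.
move=> u v e; have := leafset_subset u v; have := leafset_subset v u.
by rewrite e subxx => /esym vu /esym uv; apply: anc_anti.
Qed.

Definition leafsets : {set {set 'I_n}} := [set leafset v | v in [set~ root]]%SET.

Lemma mem_leafsets v : (leafset v \in leafsets) = (v != root).
Proof. by rewrite mem_imset ?inE //; apply: leafset_inj. Qed.

Lemma leafset_node v : leafset v \in (top r |: leafsets)%SET.
Proof.
have [->|vr] := eqVneq v root; first by rewrite leafset_root setU11.
by rewrite inE mem_leafsets vr orbT.
Qed.

Lemma nodeP I : I \in (top r |: leafsets)%SET -> exists v, I = leafset v.
Proof.
case/setU1P=> [->|/imsetP[v _ ->]]; last by exists v.
by exists root; rewrite leafset_root.
Qed.

Lemma leafset_cluster v : v != root -> cluster r (leafset v).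
Proof.
move=> vr; apply/and3P; split; first by rewrite mem_leafset eqxx.
  have [i iv] := leaf_below v; have [j jv ji] := second_leaf iv.
  by apply/card_gt1P; exists j, i.
have [i ip iv] := leaf_off_child vr; rewrite -(card_top r); apply: proper_card.
apply/properP; split; first by apply/fintype.subsetP=> j; rewrite mem_leafset !inE => /andP[].
by exists i => //; move: ip; rewrite mem_leafset !inE => /andP[].
Qed.

Lemma leafsets_hierarchy : hierarchy r leafsets.
Proof.
split=> [I /imsetP[v]|I J /imsetP[u _ ->] /imsetP[v _ ->]].
  by rewrite !inE => vr ->; apply: leafset_cluster.
rewrite /nested !leafset_subset; case: (boolP [disjoint _ & _]) => [|/pred0Pn[i /andP[]]].
  by rewrite !orbT.
rewrite orbF /= !mem_leafset => /andP[_ iu] /andP[_ iv]; exact: anc_total iu iv.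
Qed.

(** Leaf sets turn the order of the tree into inclusion, so parents can be
    computed among the leaf sets alone. *)
Lemma leafset_parent v : leafset (parent v) = par r leafsets (leafset v).
Proof.
have [->|vr] := eqVneq v root; first by rewrite parent_root leafset_root par_top.
have pv : leafset v \proper leafset (parent v).
  rewrite properEneq leafset_subset; case: (parentP vr) => _ ->; rewrite andbT.
  by apply: contraNneq (parent_neq vr) => /leafset_inj e; rewrite -e.
apply/eqP; rewrite eqEsubset; apply/andP; split; last first.
  rewrite par_min ?leafset_node //; first exact: leafsets_hierarchy.
  by have [i iv] := leaf_below v; apply/set0Pn; exists i.
have := proper_par leafsets (cluster_proper_top (leafset_cluster vr)).
have [u ->] := nodeP (par_node r leafsets (leafset v)).
rewrite properE !leafset_subset anc_parentE // => /andP[/orP[/eqP->|//]].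
by rewrite anc_refl.
Qed.

Lemma leafset_end i : i != r -> leafset (end_at T i) = par r leafsets [set i]%SET.
Proof.
move=> ir; have ii : i \in leafset (end_at T i) by rewrite mem_leafset ir anc_refl.
have it : [set i]%SET \proper top r.
  by rewrite properEcard sub1set card_top cards1 !inE ir; lia.
apply/eqP; rewrite eqEsubset; apply/andP; split; last first.
  rewrite par_min ?leafset_node //; first exact: leafsets_hierarchy.
    by rewrite -card_gt0 cards1.
  rewrite properEcard sub1set ii cards1; have [j jv ji] := second_leaf ii.
  by apply/card_gt1P; exists j, i.
have := proper_par leafsets it; have [u ->] := nodeP (par_node r leafsets [set i]%SET).
by move/proper_sub; rewrite sub1set mem_leafset leafset_subset => /andP[].
Qed.

End RootedTree.

(** * The tree of a hierarchy *)

Section TreeOfHierarchy.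
Variables (n : nat) (r : 'I_n) (F : {set {set 'I_n}}).
Hypotheses (hn : (2 < n)%N) (hF : hierarchy r F).

Let node := {I : {set 'I_n} | I \in (top r |: F)%SET}.
Implicit Types x y z : node.

Let above x : node := exist _ (par r F (val x)) (par_node r F (val x)).
Let top_node : node := exist _ (top r) (setU11 _ _).

Let hadj : rel node := fun x y => (x != y) && ((above x == y) || (above y == x)).

Let hend (i : 'I_n) : node :=
  if i == r then top_node else exist _ (par r F [set i]%SET) (par_node r F [set i]%SET).

Let node_proper x : x != top_node -> val x \proper top r.
Proof.
move=> xt; rewrite properEneq (node_subset_top hF (valP x)) andbT.
by apply: contraNneq xt => e; apply/eqP/val_inj.
Qed.

Let above_proper x : x != top_node -> val x \proper val (above x).
Proof. by move/node_proper/(proper_par F). Qed.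

Let node_neq0 x : val x != set0.
Proof. by rewrite -card_gt0 ltnW // (card_node hn hF (valP x)). Qed.

Let above_adj x : x != top_node -> hadj x (above x).
Proof.
move=> xt; rewrite /hadj eqxx /= andbT; apply: contraTneq (above_proper xt).
by move=> <-; rewrite properxx.
Qed.

Fact hadj_sym : symmetric hadj.
Proof. by move=> x y; rewrite /hadj eq_sym orbC. Qed.

Fact hadj_irr : irreflexive hadj.
Proof. by move=> x; rewrite /hadj eqxx. Qed.

Fact hadj_connected x y : connect hadj x y.
Proof.
suff H z : connect hadj z top_node.
  apply: connect_trans (H x) _; rewrite (@sym_connect_sym _ hadj); first exact: H.
  exact: hadj_sym.
have [m] := ubnP (#|top r| - #|val z|); elim: m z => // m IH z dz.
have [->|zt] := eqVneq z top_node; first exact: connect0.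
apply: connect_trans (connect1 (above_adj zt)) (IH _ _).
have := proper_card (above_proper zt); have := proper_card (node_proper zt); lia.
Qed.

(** A vertex of a cycle with fewest leaves has both its neighbours above it,
    so these coincide. *)
Fact hadj_acyclic c : cycle hadj c -> uniq c -> (size c <= 2)%N.
Proof.
case: c => // x0 c' cc uc; set c := x0 :: c' in cc uc *.
have [x xc xmin] := arg_minnP (fun x => #|val x|) (mem_head x0 c' : (mem c) x0).
have [i s e] := rot_to xc.
have cs : cycle hadj (x :: s) by rewrite -e rot_cycle.
have us : uniq (x :: s) by rewrite -e rot_uniq.
have xmin' y : y \in s -> (#|val x| <= #|val y|)%N.
  by move=> ys; apply: xmin; rewrite inE -(mem_rot i) e inE ys orbT.
have up y : y \in s -> hadj x y -> y = above x.
  move=> ys /andP[xy /orP[/eqP//|/eqP ay]].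
  have yt : y != top_node.
    apply: contraNneq xy => yt; rewrite -ay yt; apply/eqP/val_inj.
    by rewrite /= par_top.
  by have := proper_card (above_proper yt); rewrite ay ltnNge xmin'.
rewrite -(size_rot i) e; case: s cs us xmin' up {e} => [//|y [//|z s]] cs us xmin' up.
have ey : y = above x by apply: up; [exact: mem_head | case/andP: cs].
have ez : last z s = above x.
  apply: up; first by rewrite inE mem_last orbT.
  by move: cs; rewrite (cycle_path x) /= hadj_sym => /andP[].
by move: us; rewrite /= ey -ez mem_last /= andbF.
Qed.

Let child_above x K : K \in children r F (val x) -> par r F K = val x.
Proof. by rewrite inE => /and3P[_ _ /eqP]. Qed.

(** A node has two children, which account for two neighbours or ends, and a
    third one is the parent, or the end [r] at [top]. *)
Fact hadj_valence x :
  (3 <= #|[set y | hadj x y]%SET| + #|[set i | hend i == x]%SET|)%N.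
Proof.
pose N := (val @: [set y | hadj x y]%SET :|: [set [set i]%SET | i in [set i | hend i == x]%SET])%SET.
apply: (@leq_trans #|N|); last first.
  by apply: leq_trans (leq_card_setU _ _) _; apply: leq_add; apply: leq_imset_card.
have childN K : K \in children r F (val x) -> K \in N.
  move=> Kx; have Kp := child_proper hF Kx.
  case/setUP: (child_tree_node Kx) => [Kn|/imsetP[i it eK]]; apply/setUP.
    left; apply/imsetP; exists (exist _ K Kn : node) => //; rewrite inE /hadj.
    apply/andP; split; first by apply: contraTneq Kp => ->; rewrite properxx.
    by apply/orP; right; apply/eqP/val_inj; rewrite /= (child_above Kx).
  right; apply/imsetP; exists i => //; rewrite inE /hend.
  have /negPf-> : i != r by move: it; rewrite !inE.
  by apply/eqP/val_inj; rewrite /= -eK (child_above Kx).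
have [a [b [K [L [Kx Lx aK bL bK]]]]] := two_children hn hF (valP x).
have [M MN [KM LM]] : exists2 M, M \in N & K != M /\ L != M.
  have sub_top K' : K' \in children r F (val x) -> K' \subset top r.
    move=> /(child_proper hF)/proper_sub/subset_trans; apply; exact: node_subset_top (valP x).
  have [xt|xt] := eqVneq x top_node.
    exists [set r]%SET.
      by apply/setUP; right; apply: imset_f; rewrite inE /hend eqxx xt.
    suff H K' : K' \in children r F (val x) -> K' != [set r]%SET by split; apply: H.
    by move=> /sub_top; apply: contraTneq => ->; rewrite sub1set !inE eqxx.
  exists (val (above x)).
    by apply/setUP; left; apply: imset_f; rewrite inE above_adj.
  suff H K' : K' \in children r F (val x) -> K' != val (above x) by split; apply: H.
  move=> /(child_proper hF) Kp; apply/proper_neq; exact: proper_trans Kp (above_proper xt).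
have KL : K != L by apply: contraNneq bK => ->.
apply/card_gt2P; exists K, L, M; split; first by split=> //; apply: childN.
by split=> //; rewrite eq_sym.
Qed.

Definition hierarchy_tree : tree_type n :=
  TreeType hadj_sym hadj_irr hadj_connected hadj_acyclic hadj_valence.

Let T := hierarchy_tree.

Let end_root : end_at T r = top_node :> T.
Proof. by rewrite /= /hend eqxx. Qed.

Lemma hierarchy_tree_anc (x y : T) : anc r x y = (val x \subset val y).
Proof.
have [m] := ubnP (#|top r| - #|val x|); elim: m x y => // m IH x y dx.
have [xt|xt] := eqVneq x (top_node : T).
  rewrite xt; apply/idP/idP.
    by rewrite -[X in anc _ X]end_root => /root_anc ->; rewrite end_root.
  move=> /= ty; suff -> : y = top_node by rewrite -end_root anc_root.
  by apply/val_inj/eqP; rewrite eqEsubset ty (node_subset_top hF (valP y)).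
have xr : x != end_at T r by rewrite end_root.
have ax : val x \proper val (above x) := above_proper xt.
have IHa (z : T) : anc r (above x : T) z = (val (above x) \subset val z).
  apply: IH; have := proper_card (above_proper xt); have := proper_card (node_proper xt).
  by move: dx; rewrite /=; lia.
have axadj : @adj n T (above x) x by rewrite adj_sym; exact: above_adj.
have xa : anc r x (above x).
  case/orP: (adj_anc r axadj) => //; rewrite IHa => /(proper_sub_trans ax).
  by rewrite properxx.
rewrite anc_parentE // (parentE axadj xa) IHa; apply/orP/idP.
  by case=> [/eqP->//|]; apply: subset_trans; apply: proper_sub.
rewrite subEproper => /predU1P[e|xy]; [left|right].
  by apply/eqP/val_inj.
exact: (par_min hF (node_neq0 x) (valP y) xy).
Qed.

Lemma hierarchy_tree_leafset (x : T) : leafset r x = val x.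
Proof.
apply/setP=> i; rewrite mem_leafset; have [->|ir] /= := eqVneq i r.
  apply/esym/negbTE/negP=> /(subsetP (node_subset_top hF (valP x))).
  by rewrite !inE eqxx.
rewrite hierarchy_tree_anc /hend (negPf ir) /=.
have it : [set i]%SET \proper top r.
  by rewrite properEcard sub1set card_top cards1 !inE ir; lia.
apply/idP/idP=> [/subsetP|ix].
  by apply; have := proper_sub (proper_par F it); rewrite sub1set.
apply: (par_min hF _ (valP x)); first by rewrite -card_gt0 cards1.
by rewrite properEcard sub1set ix cards1 (card_node hn hF (valP x)).
Qed.

Lemma hierarchy_tree_leafsets : leafsets T r = F.
Proof.
have tF : top r \notin F := top_notin hF.
apply/setP=> I; apply/imsetP/idP=> [[x]|IF].
  rewrite !inE hierarchy_tree_leafset => xt ->; apply: (node_neq_top (valP x)).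
  by apply: contraNneq xt => e; rewrite end_root; apply/eqP/val_inj.
have In : I \in (top r |: F)%SET by rewrite inE IF orbT.
exists (exist _ I In : T); last by rewrite hierarchy_tree_leafset.
rewrite !inE end_root; apply: contraNneq tF => /(congr1 val) /= <-; exact: IF.
Qed.

End TreeOfHierarchy.

(** * Isomorphisms of curves *)

Section CurveIso.
Variables (R : realType) (n : nat) (r : 'I_n) (G H : trop_curve R n).
Hypothesis hn : (2 < n)%N.

(** A vertex is known by its leaf set, and both the vertex above it and the
    vertex of each end can be read off from the hierarchy of leaf sets. *)
Lemma leafsets_curve_iso : leafsets G r = leafsets H r ->
    (forall (v : G) (w : H), v != end_at G r -> leafset r v = leafset r w ->
       edge_len r (@len R n G) v = edge_len r (@len R n H) w) ->
  curve_iso G H.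
Proof.
move=> eF elen.
have ex_f (v : G) : exists w : H, leafset r w == leafset r v.
  have := leafset_node r v; rewrite eF => /nodeP[w ->]; by exists w.
have ex_g (w : H) : exists v : G, leafset r v == leafset r w.
  have := leafset_node r w; rewrite -eF => /nodeP[v ->]; by exists v.
pose f v := xchoose (ex_f v); pose g w := xchoose (ex_g w).
have fE v : leafset r (f v) = leafset r v by apply/eqP/(xchooseP (ex_f v)).
have gE w : leafset r (g w) = leafset r w by apply/eqP/(xchooseP (ex_g w)).
have fbij : bijective f.
  exists g => v; apply: (@leafset_inj _ _ r); first by rewrite gE fE.
  by rewrite fE gE.
have finj := bij_inj fbij.
have fpar v : parent r (f v) = f (parent r v).
  by apply: (@leafset_inj _ _ r); rewrite fE !leafset_parent // eF fE.
have froot : f (end_at G r) = end_at H r.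
  by apply: (@leafset_inj _ _ r); rewrite fE !leafset_root.
exists f; split=> // [x y|i|].
- by rewrite !(adjE r) !fpar !(inj_eq finj).
- have [->//|ir] := eqVneq i r; apply: (@leafset_inj _ _ r).
  by rewrite fE !leafset_end // eF.
suff S x : x != end_at G r ->
    @len R n H [set f x; f (parent r x)]%SET = @len R n G [set x; parent r x]%SET.
  move=> x y; rewrite (adjE r) => /andP[xy /orP[/eqP e|/eqP e]].
    by rewrite -e S //; apply: contraNneq xy => ex; rewrite -e ex parent_root.
  rewrite [in LHS]setUC [in RHS]setUC -e S //.
  by apply: contraNneq xy => ey; rewrite -e ey parent_root.
by move=> xr; rewrite -fpar; apply/esym/elen.
Qed.

Lemma curve_iso_tree_dist (f : G -> H) : injective f ->
    (forall x y, adj (f x) (f y) = adj x y) ->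
    (forall x y, adj x y ->
       @len R n H [set f x; f y]%SET = @len R n G [set x; y]%SET) ->
  forall x y, tree_dist (@len R n H) (f x) (f y) = tree_dist (@len R n G) x y.
Proof.
move=> finj fadj flen x y; have /and3P[px /eqP lx ux] := tree_pathP x y.
rewrite /tree_dist; have <- : map f (tree_path x y) = tree_path (f x) (f y).
  apply: (simple_path_unique); rewrite /simple_path last_map lx eqxx.
  rewrite -map_cons (map_inj_uniq finj) ux /=.
  by rewrite andbT path_map (eq_path (fun u v => fadj u v)).
move: (tree_path x y) px {lx ux} => p; elim: p x => [|z p IH] x /=; first by rewrite !big_nil.
by case/andP=> xz zp; rewrite !big_cons IH // flen.
Qed.

End CurveIso.

(** * Coordinates on the quotient *)

Section GromovCoordinates.
Variables (R : realType) (n : nat) (r : 'I_n).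
Implicit Types (x y : dist_space R n) (i j a b : 'I_n) (I J S : {set 'I_n}).

Definition dcoord x i j : R :=
  if insub (i, j) is Some p then x p else
  if insub (j, i) is Some p then x p else 0.

Lemma dcoordE x (f : 'I_n -> 'I_n -> R) : (forall i j, f i j = f j i) ->
  (forall p : pair_index n, x p = f (val p).1 (val p).2) ->
  forall i j, i != j -> dcoord x i j = f i j.
Proof.
move=> fC xf i j ij; rewrite /dcoord; case: insubP => [p _ e|/= nij].
  by rewrite xf e.
case: insubP => [p _ e|/= nji]; first by rewrite xf e fC.
by move: ij nij nji; rewrite -val_eqE /= -!leqNgt; case: ltngtP.
Qed.

Lemma dcoord_pair x (p : pair_index n) : dcoord x (val p).1 (val p).2 = x p.
Proof. by rewrite /dcoord -surjective_pairing valK. Qed.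

Lemma dcoordP x y : (forall i j, i != j -> dcoord x i j = dcoord y i j) -> x = y.
Proof.
move=> H; apply/ffunP => p; rewrite -!dcoord_pair; apply: H.
by rewrite -val_eqE neq_ltn (valP p).
Qed.

Lemma dcoord_lin k x y i j : dcoord (k *: x + y) i j = k * dcoord x i j + dcoord y i j.
Proof.
rewrite /dcoord; case: insubP => [p _ _|_]; first by rewrite !ffunE.
case: insubP => [p _ _|_]; first by rewrite !ffunE.
by rewrite mulr0 addr0.
Qed.

Lemma dcoord_diag x i : dcoord x i i = 0.
Proof. by rewrite /dcoord insubF //= ltnn. Qed.

Lemma dcoordC x i j : dcoord x i j = dcoord x j i.
Proof.
rewrite /dcoord; case: insubP => [p /= ij _|_]; last by [].
by rewrite insubF //= ltnNge ltnW.
Qed.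

Lemma dcoord_Phi (s : {ffun 'I_n -> R^o}) i j : i != j ->
  dcoord (Phi s) i j = s i + s j.
Proof.
apply: (dcoordE (f := fun i j => s i + s j)) => [k l|p]; first exact: addrC.
by rewrite ffunE.
Qed.

(** The distance vector of the tree with a single edge, of length 1, that
    separates [I] from its complement. *)
Definition split_dist I : dist_space R n :=
  [ffun p => (((val p).1 \in I) (+) ((val p).2 \in I))%:R].

Definition sv I : Qn R n := qproj _ (split_dist I).

Lemma dcoord_split I i j : i != j ->
  dcoord (split_dist I) i j = ((i \in I) (+) (j \in I))%:R.
Proof.
apply: (dcoordE (f := fun i j => ((i \in I) (+) (j \in I))%:R)) => [k l|p].
  by rewrite addbC.
by rewrite ffunE.
Qed.

Lemma sv_setC I : sv (~: I)%SET = sv I.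
Proof.
congr (qproj _ _); apply/ffunP => p; rewrite !ffunE !inE.
by case: (_ \in I) (_ \in I) => [] [].
Qed.

Definition leafpair S := (#|S| == 2%N) && (r \notin S).

(** For a pair [S], the Gromov product of its elements with respect to [r]; the
    double sum counts their distance twice. *)
Definition gromov x S : R :=
  (\sum_(a in S) dcoord x a r - (\sum_(a in S) \sum_(b in S) dcoord x a b) / 2) / 2.

Lemma leafpairP S : leafpair S -> exists a b,
  [/\ a != b, a != r, b != r & S = [set a; b]%SET].
Proof.
case/andP=> /cards2P[a [b [ab ->]]]; rewrite !inE negb_or !(eq_sym r) => /andP[ar br].
by exists a, b.
Qed.

Lemma leafpair_set2 a b : a != b -> r != a -> r != b -> leafpair [set a; b]%SET.
Proof. by move=> ab ra rb; rewrite /leafpair cards2 ab !inE negb_or ra rb. Qed.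

Lemma gromovE x a b : a != b ->
  gromov x [set a; b]%SET = (dcoord x a r + dcoord x b r - dcoord x a b) / 2.
Proof.
move=> ab; have a_b : a \notin [set b]%SET by rewrite inE.
rewrite /gromov !big_setU1 //= !big_set1 !big_setU1 //= !big_set1 !dcoord_diag.
by rewrite (dcoordC x b a); field.
Qed.

Lemma gromov_lin k x y S : gromov (k *: x + y) S = k * gromov x S + gromov y S.
Proof.
rewrite /gromov; under eq_bigr do rewrite dcoord_lin.
under [X in _ - X / 2]eq_bigr do under eq_bigr do rewrite dcoord_lin.
under [X in _ - X / 2]eq_bigr do rewrite big_split -mulr_sumr.
rewrite !big_split /= -!mulr_sumr; set A := \sum_(a in S) _; set B := \sum_(a in S) _.
set C := \sum_(a in S) _; set D := \sum_(a in S) _.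
by field.
Qed.

Lemma gromov_Phi (s : {ffun 'I_n -> R^o}) S : leafpair S -> gromov (Phi s) S = s r.
Proof.
case/leafpairP=> a [b [ab ar br ->]]; rewrite gromovE // !dcoord_Phi //.
by move: (s a : R) (s b : R) (s r : R) => ta tb tr; field.
Qed.

Lemma gromov_split I S : leafpair S -> r \notin I ->
  gromov (split_dist I) S = (S \subset I)%:R.
Proof.
case/leafpairP=> a [b [ab ar br ->]] rI; rewrite gromovE // !dcoord_split //.
rewrite (negPf rI) !addbF subUset !sub1set.
by case: (a \in I) (b \in I) => [] [] /=; field.
Qed.

(** Gromov products are defined on the quotient only up to a common constant,
    so only their differences are functions on it. *)
Definition gromov_diff S S' (q : Qn R n) : R^o :=
  if leafpair S && leafpair S' then gromov (repr q) S - gromov (repr q) S' else 0.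

Lemma gromov_diffE S S' x : leafpair S -> leafpair S' ->
  gromov_diff S S' (qproj _ x) = gromov x S - gromov x S'.
Proof.
move=> pS pS'; rewrite /gromov_diff pS pS' /=; set y := repr _.
have : y - x \in limg (linfun (@Phi R n)) by rewrite -qproj_eq /y /qproj reprK.
case/memv_imgP=> s _; rewrite lfunE /= => e.
have -> : y = 1 *: Phi s + x by rewrite -e scale1r subrK.
by rewrite !gromov_lin !gromov_Phi //; ring.
Qed.

Fact gromov_diff_linear S S' : linear (gromov_diff S S').
Proof.
move=> k q q'; have [x <-] := qproj_surj q; have [x' <-] := qproj_surj q'.
rewrite -linearP; case: (boolP (leafpair S && leafpair S')) => [/andP[pS pS']|/negPf p].
  rewrite !gromov_diffE // !gromov_lin /GRing.scale /=; ring.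
by rewrite /gromov_diff p scaler0 addr0.
Qed.

HB.instance Definition _ S S' :=
  GRing.isLinear.Build R (Qn R n) R^o *:%R (gromov_diff S S') (gromov_diff_linear S S').

Definition gdiff S S' : 'Hom(Qn R n, R^o) := linfun (gromov_diff S S').

Lemma gdiff_sv S S' I : leafpair S -> leafpair S' -> r \notin I ->
  gdiff S S' (sv I) = (S \subset I)%:R - (S' \subset I)%:R.
Proof. by move=> pS pS' rI; rewrite lfunE /= gromov_diffE // !gromov_split. Qed.

Definition gdiffs : seq 'Hom(Qn R n, R^o) :=
  [seq gdiff p.1 p.2 | p <- enum {: {set 'I_n} * {set 'I_n}}].

Lemma mem_gdiffs S S' : gdiff S S' \in gdiffs.
Proof. by apply/mapP; exists (S, S'); rewrite ?mem_enum. Qed.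

(** If all Gromov products of [x] equal [k], then [x i j] is the sum of
    [x i r - k] and [x j r - k]. *)
Lemma gdiffs_sep (q : Qn R n) : (forall S S', gdiff S S' q = 0) -> q = 0.
Proof.
have [x <-] := qproj_surj q => H.
have [k xk] : exists k, forall S, leafpair S -> gromov x S = k.
  have [[S0 pS0]|N] := pselect (exists S, leafpair S); last first.
    by exists 0 => S pS; case: N; exists S.
  exists (gromov x S0) => S pS; apply/eqP; rewrite -subr_eq0.
  by rewrite -gromov_diffE //; have := H S S0; rewrite lfunE /= => ->.
apply/eqP; rewrite qproj_eq0.
pose s : {ffun 'I_n -> R^o} := [ffun i => if i == r then k else dcoord x i r - k].
suff -> : x = linfun (@Phi R n) s by apply: memv_img; apply: memvf.
rewrite lfunE; apply: dcoordP => i j ij; rewrite dcoord_Phi // !ffunE.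
case: eqP => [ei|/eqP ir].
  by rewrite ei eq_sym in ij *; rewrite (negPf ij) dcoordC addrCA subrr addr0.
case: eqP => [->|/eqP jr]; first by rewrite subrK.
have := xk [set i; j]%SET; rewrite leafpair_set2 // 1?eq_sym // gromovE //.
by move=> /(_ isT) <-; field.
Qed.

(** * The lattice *)

Lemma end_splitP (I : end_split n) : exists2 J, cluster r J & sv (val I) = sv J.
Proof.
have /andP[I1 In] := valP I; have [rI|rI] := boolP (r \in val I); last first.
  by exists (val I) => //; rewrite /cluster rI I1 In.
exists (~: val I)%SET; last by rewrite sv_setC.
have := cardsC (val I); rewrite card_ord => e.
rewrite /cluster inE rI /=; move: #|~: val I|%SET #|val I| e I1 In => a b; lia.
Qed.

Lemma tree_dist_one_edge (I : end_split n) (b c : one_edge_type I) :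
  tree_dist (fun=> 1) b c = (b (+) c)%:R :> R.
Proof.
have [<-|bc] := eqVneq b c; first by rewrite addbb /tree_dist tree_path_refl big_nil.
rewrite /tree_dist -(@simple_path_unique _ (one_edge_type I) b c [:: c]).
  by rewrite /= big_seq1; case: (b) (c) bc => [] [].
by rewrite /simple_path /= !eqxx !andbT inE; apply/andP.
Qed.

Lemma split_vecE (I : end_split n) : split_vec R n I = sv (val I).
Proof.
congr (qproj _ _); apply/ffunP => p; rewrite !ffunE.
exact: tree_dist_one_edge.
Qed.

Local Open Scope classical_set_scope.

Lemma range_split_vec : range (split_vec R n) = sv @` [set I | cluster r I].
Proof.
apply/seteqP; split=> q [I].
  by move=> _ <-; rewrite split_vecE; have [J cJ ->] := end_splitP I; exists J.
move=> /= cI <-; have /and3P[_ I1 In] := cI.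
have pI : (1 < #|I| < n.-1)%N by rewrite I1.
by exists (exist _ I pI : end_split n); rewrite ?split_vecE.
Qed.

Lemma split_latticeE : split_lattice R n = zspan (sv @` [set I | cluster r I]).
Proof. by rewrite /split_lattice range_split_vec. Qed.

Lemma sv_lattice I : cluster r I -> split_lattice R n (sv I).
Proof. by move=> cI; rewrite split_latticeE; apply: zspan_gen; exists I. Qed.

Lemma gdiff_dual S S' : dual_lattice (split_lattice R n) (gdiff S S').
Proof.
rewrite split_latticeE; apply: dual_zspan => _ [I /and3P[rI _ _] <-].
have [/andP[pS pS']|p] := boolP (leafpair S && leafpair S').
  by rewrite gdiff_sv // rpredB // rpred_nat.
by rewrite lfunE /= /gromov_diff (negPf p) rpred0.
Qed.

Lemma gdiffs_dual l : l \in gdiffs -> dual_lattice (split_lattice R n) l.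
Proof. by case/mapP=> p _ ->; apply: gdiff_dual. Qed.

End GromovCoordinates.

(** * The cones of hierarchies *)

Section HierarchyCones.
Local Open Scope classical_set_scope.
Variables (R : realType) (n : nat) (r : 'I_n).
Hypothesis hn : (2 < n)%N.
Implicit Types (F G : {set {set 'I_n}}) (I J : {set 'I_n}) (c : {set 'I_n} -> R).

Let L := split_lattice R n.
Local Notation sv := (@sv R n).

(** For [I] in [F], take the quartet functional of a triple that no other
    cluster of [F] separates. *)
Lemma hierarchy_dual F : hierarchy r F ->
  exists u : {set 'I_n} -> 'Hom(Qn R n, R^o),
    (forall I, I \in F -> dual_lattice L (u I)) /\
    (forall I J, I \in F -> J \in F -> u I (sv J) = (I == J)%:R).
Proof.
move=> hF.
have /choice[u uP] I : exists l : 'Hom(Qn R n, R^o), I \in F ->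
    dual_lattice L l /\ forall J, J \in F -> l (sv J) = (I == J)%:R.
  have [IF|IF] := boolP (I \in F); last by exists 0 => IF'; case/negP: IF.
  have [a [b [c [ab ac /and3P[ra rb rc] H]]]] := dual_triple hn hF IF.
  exists (gdiff R r [set a; b]%SET [set a; c]%SET) => _; split; first exact: gdiff_dual.
  move=> J JF; have /and3P[rJ _ _] := proj1 hF J JF.
  rewrite gdiff_sv ?leafpair_set2 //; have [-> ->] := H J JF.
  rewrite properEneq; case: (I \subset J) / boolP => IJ; rewrite ?andbF ?andbT.
    by case: (I == J); rewrite ?subr0 ?subrr.
  by rewrite subrr; case: eqP => // e; rewrite e subxx in IJ.
by exists u; split=> [I IF|I J IF JF]; have [uL uv] := uP I IF; [apply: uL|apply: uv].
Qed.

Lemma sv_hierarchy F I : hierarchy r F -> I \in F -> L (sv I).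
Proof. by move=> hF /(proj1 hF); apply: sv_lattice. Qed.

Definition hcone F := cone sv F.

Lemma hcone_set1 I : hcone [set I]%SET = cone_gen [:: sv I].
Proof. exact: cone_set1. Qed.

Let lat : L = zspan (sv @` [set I | cluster r I]) := split_latticeE R r.

Let gdiffs_dual' l : l \in gdiffs R r -> dual_lattice (zspan (sv @` [set I | cluster r I])) l.
Proof. by rewrite -lat; apply: gdiffs_dual. Qed.

Let gdiffs_sep' x : (forall l, l \in gdiffs R r -> l x = 0) -> x = 0.
Proof. by move=> H; apply: (@gdiffs_sep R n r) => S S'; apply/H/mem_gdiffs. Qed.

Section OneHierarchy.
Variable F : {set {set 'I_n}}.
Hypothesis hF : hierarchy r F.

Let svL I : I \in F -> zspan (sv @` [set I | cluster r I]) (sv I).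
Proof. by rewrite -lat; apply: sv_hierarchy. Qed.

Lemma hcone_is_cone : is_cone L (hcone F).
Proof.
have [u [uL uv]] := hierarchy_dual hF; move: uL; rewrite lat => uL.
exact: (cone_is_cone gdiffs_dual' gdiffs_sep' svL uL uv).
Qed.

Lemma hcone_face G : G \subset F -> is_face L (hcone G) (hcone F).
Proof.
have [u [uL uv]] := hierarchy_dual hF; move: uL; rewrite lat => uL.
exact: (cone_face gdiffs_dual' gdiffs_sep' svL uL uv).
Qed.

Lemma face_hcone C : is_face L C (hcone F) ->
  exists2 G : {set {set 'I_n}}, G \subset F & C = hcone G.
Proof. by rewrite lat; apply: face_cone. Qed.

Lemma cdim_hcone : cdim (hcone F) = #|F|.
Proof. by have [u [uL uv]] := hierarchy_dual hF; apply: (cdim_cone uv). Qed.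

Lemma hcone_simplicial : simplicial (hcone F).
Proof. by have [u [uL uv]] := hierarchy_dual hF; apply: (cone_simplicial uv). Qed.

Lemma sublattice_hcone : sublattice L (hcone F) = zspan (sv @` [set` F]).
Proof.
have [u [uL uv]] := hierarchy_dual hF; move: uL; rewrite lat => uL.
exact: (sublattice_cone svL uL uv).
Qed.

End OneHierarchy.

(** The quartet ab|cr takes a positive value on a point of [hcone F'] only if
    some cluster in its support displays it; so the hierarchy of the support
    is known from the point. *)
Lemma hcone_support F F' c c' I : hierarchy r F -> hierarchy r F' ->
    (forall J, J \in F -> 0 <= c J) -> (forall J, J \in F' -> 0 <= c' J) ->
    \sum_(J in F) c J *: sv J = \sum_(J in F') c' J *: sv J ->
  I \in F -> 0 < c I -> I \in F'.
Proof.
move=> hF hF' c0 c'0 e IF cI; apply: (mem_hierarchy_triples hF' (proj1 hF _ IF)).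
move=> a b d aI bI ab dt dI.
have /and3P[rI _ _] := proj1 hF _ IF.
have ra : r != a by apply: contraNneq rI => ->.
have rb : r != b by apply: contraNneq rI => ->.
have rd : r != d by move: dt; rewrite !inE eq_sym.
have ad : a != d by apply: contraNneq dI => <-.
pose l := gdiff R r [set a; b]%SET [set a; d]%SET.
have lE E k : hierarchy r E -> l (\sum_(J in E) k J *: sv J) =
    \sum_(J in E) k J * (([set a; b]%SET \subset J)%:R - ([set a; d]%SET \subset J)%:R).
  move=> hE; rewrite linear_sum; apply: eq_bigr => J JE.
  have /and3P[rJ _ _] := proj1 hE _ JE.
  by rewrite linearZ /= /l gdiff_sv ?leafpair_set2.
have : 0 < l (\sum_(J in F) c J *: sv J).
  rewrite lE // (bigD1 I) //=; apply: ltr_pwDl.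
    by rewrite !subUset !sub1set aI bI (negPf dI) /= subr0 mulr1.
  apply: sumr_ge0 => J /andP[JF _]; rewrite mulr_ge0 ?c0 // subr_ge0 ler_nat.
  have [adJ|//] := boolP ([set a; d]%SET \subset J).
  move: adJ; rewrite !subUset !sub1set => /andP[aJ dJ]; rewrite aJ /=.
  case/orP: (nested_meet (proj2 hF _ _ IF JF) aI aJ) => /subsetP; first by move->.
  by move/(_ _ dJ); rewrite (negPf dI).
rewrite e lE // => pos.
have /existsP[J /and3P[JF' abJ adJ]] :
    [exists J, [&& J \in F', [set a; b]%SET \subset J & ~~ ([set a; d]%SET \subset J)]].
  apply: contraTT pos; rewrite negb_exists => /forallP H; rewrite -leNgt.
  apply: sumr_le0 => J JF'; rewrite mulr_ge0_le0 ?c'0 // subr_le0 ler_nat.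
  by have := H J; rewrite JF' /=; case: (_ \subset _); case: (_ \subset _).
exists J => //; move: abJ adJ; rewrite !subUset !sub1set => /andP[aJ bJ].
by rewrite aJ.
Qed.

(** The functional dual to [I] in [F] reads off both coefficients, because the
    support on the side of [F'] is contained in [F]. *)
Lemma hcone_coef F F' c c' I : hierarchy r F -> hierarchy r F' ->
    (forall J, J \in F -> 0 <= c J) -> (forall J, J \in F' -> 0 <= c' J) ->
    \sum_(J in F) c J *: sv J = \sum_(J in F') c' J *: sv J ->
  I \in F -> I \in F' -> c I = c' I.
Proof.
move=> hF hF' c0 c'0 e IF IF'; have [u [uL uv]] := hierarchy_dual hF.
have := congr1 (u I) e; rewrite (coord_sum uv) ?subxx // IF mul1r => ->.
rewrite linear_sum (bigD1 I) //= linearZ /= uv // eqxx big1 ?addr0.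
  by rewrite /GRing.scale /= mulr1.
move=> J /andP[JF' JI]; have := c'0 _ JF'; rewrite le_eqVlt => /predU1P[<-|c'J].
  by rewrite scale0r linear0.
have JF := hcone_support hF' hF c'0 c0 (esym e) JF' c'J.
by rewrite linearZ /= uv // eq_sym (negPf JI) scaler0.
Qed.

Lemma hcone_sub F F' : hierarchy r F -> hierarchy r F' -> hcone F `<=` hcone F' ->
  F \subset F'.
Proof.
move=> hF hF' sFF; apply/subsetP => I IF.
have [c' c'0 e] := sFF _ (mem_cone sv IF).
have [c c0 e0] := mem_cone sv IF.
have [u [uL uv]] := hierarchy_dual hF.
have cI : c I = 1.
  by have := congr1 (u I) e0; rewrite (coord_sum uv) ?subxx // IF mul1r uv // eqxx.
by apply: (hcone_support hF hF' c0 c'0) => //; rewrite ?cI -?e0.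
Qed.

Lemma hcone_inj F F' : hierarchy r F -> hierarchy r F' -> hcone F = hcone F' -> F = F'.
Proof.
move=> hF hF' e; apply/eqP; rewrite eqEsubset !hcone_sub // e //.
Qed.

Lemma sub_hcone F G : G \subset F -> hcone G `<=` hcone F.
Proof.
move=> GF x [c c0 ->]; exists (fun I => (I \in G)%:R * c I) => [I _|].
  by case: (boolP (I \in G)) => IG; rewrite ?mul0r // mul1r c0.
rewrite [RHS](big_setID G) /= (setIidPr GF) [X in _ + X]big1 ?addr0 => [|I /setDP[_ IG]].
  by apply: eq_bigr => I ->; rewrite mul1r.
by rewrite (negPf IG) mul0r scale0r.
Qed.

Lemma hcone_setI F F' : hierarchy r F -> hierarchy r F' ->
  hcone F `&` hcone F' = hcone (F :&: F')%SET.
Proof.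
move=> hF hF'; apply/seteqP; split=> [x [[c c0 xE] [c' c'0 xE']]|x xFF]; last first.
  by split; move: xFF; apply: sub_hcone; rewrite ?subsetIl ?subsetIr.
exists c => [I /setIP[IF _]|]; first exact: c0.
rewrite {1}xE (big_setID F') /= [X in _ + X]big1 ?addr0 // => I /setDP[IF IF'].
have := c0 _ IF; rewrite le_eqVlt => /predU1P[<-|cI]; first by rewrite scale0r.
by rewrite (hcone_support hF hF' c0 c'0 _ IF cI) ?(negPf IF') // -xE in IF'.
Qed.

(** * Type cones are the cones of hierarchies *)

Section TypeCone.
Variable T : tree_type n.

Implicit Types v w : T.

Lemma dist_vec_leafsets (len : {set T} -> R) : dist_vec len =
  \sum_(v : T | v != end_at T r) edge_len r len v *: split_dist R (leafset r v).
Proof.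
apply/ffunP => p; rewrite ffunE (tree_distE r) sum_ffunE; apply: eq_bigr => v vr.
rewrite !ffunE /GRing.scale /=; congr (_ * (_ (+) _)%:R); rewrite mem_leafset.
  by case: eqP => // ->; apply/negbTE; apply: contra vr => /root_anc->.
by case: eqP => // ->; apply/negbTE; apply: contra vr => /root_anc->.
Qed.

Lemma sum_leafsets (V : zmodType) (f : {set 'I_n} -> V) :
  \sum_(I in leafsets T r) f I = \sum_(v : T | v != end_at T r) f (leafset r v).
Proof.
rewrite /leafsets big_imset /=; last by move=> v w _ _; apply: leafset_inj.
by apply: eq_bigl => v; rewrite !inE.
Qed.

(** Distinct vertices have distinct leaf sets, so at most one term occurs. *)
Definition split_weight (len : {set T} -> R) I : R :=
  \sum_(v : T | (v != end_at T r) && (leafset r v == I)) edge_len r len v.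

Lemma split_weight_leafset len v : v != end_at T r ->
  split_weight len (leafset r v) = edge_len r len v.
Proof.
move=> vr; rewrite /split_weight (big_pred1 v) // => w.
rewrite (inj_eq (@leafset_inj _ _ _)) /=; have [->|_] := eqVneq w v; last exact: andbF.
by rewrite vr.
Qed.

Lemma qproj_dist_vec (len : {set T} -> R) :
  qproj _ (dist_vec len) = \sum_(I in leafsets T r) split_weight len I *: sv I.
Proof.
rewrite dist_vec_leafsets linear_sum sum_leafsets; apply: eq_bigr => v vr.
by rewrite linearZ split_weight_leafset.
Qed.

(** An edge has only one lower end, so at most one term occurs. *)
Definition weight_len c (e : {set T}) : R :=
  \sum_(v : T | (v != end_at T r) && (e == [set v; parent r v]%SET)) c (leafset r v).

Lemma edge_inj v w : v != end_at T r -> w != end_at T r ->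
  [set v; parent r v]%SET = [set w; parent r w]%SET -> v = w.
Proof.
move=> vr wr e; case/orP: (set2_mem e) => [/eqP//|/eqP vpw].
case/orP: (set2_mem (esym e)) => [/eqP//|/eqP wpv].
have := depth_parent vr; rewrite -wpv (depth_parent wr) -vpw; lia.
Qed.

Lemma edge_len_weight c v : v != end_at T r ->
  edge_len r (weight_len c) v = c (leafset r v).
Proof.
move=> vr; rewrite /edge_len /weight_len (big_pred1 v) // => w.
apply/andP/eqP => [[wr /eqP e]|->]; last by rewrite vr eqxx.
exact/esym/edge_inj.
Qed.

Lemma weight_len_ge0 c e : (forall I, I \in leafsets T r -> 0 <= c I) ->
  0 <= weight_len c e.
Proof. by move=> c0; apply: sumr_ge0 => v /andP[vr _]; apply: c0; rewrite mem_leafsets. Qed.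

Lemma weight_len_gt0 c : (forall I, I \in leafsets T r -> 0 < c I) ->
  forall v w, adj v w -> 0 < weight_len c [set v; w]%SET.
Proof.
move=> c0 v w /(adj_lower r)[x [xr -> _]].
by rewrite -/(edge_len r (weight_len c) x) edge_len_weight // c0 // mem_leafsets.
Qed.

Lemma qproj_weight_len c :
  qproj _ (dist_vec (weight_len c)) = \sum_(I in leafsets T r) c I *: sv I.
Proof.
rewrite qproj_dist_vec !sum_leafsets; apply: eq_bigr => v vr.
by rewrite split_weight_leafset // edge_len_weight.
Qed.

Lemma split_weight_ge0 (len : {set T} -> R) :
  (forall v w, adj v w -> 0 <= len [set v; w]%SET) ->
  forall I, 0 <= split_weight len I.
Proof.
move=> len0 I; apply: sumr_ge0 => v /andP[vr _]; apply: len0.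
by rewrite adj_sym; case: (parentP vr).
Qed.

Lemma type_coneE : type_cone T = hcone (leafsets T r).
Proof.
apply/seteqP; split=> q.
  move=> [len /= len0 <-]; exists (split_weight len); last exact: qproj_dist_vec.
  by move=> I _; apply: split_weight_ge0.
move=> [c c0 ->]; exists (weight_len c); last exact: qproj_weight_len.
by move=> v w _; apply: weight_len_ge0.
Qed.

End TypeCone.

Lemma moduli_fanP C : moduli_fan R n C <-> exists2 F, hierarchy r F & C = hcone F.
Proof.
split=> [[T ->]|[F hF ->]].
  by exists (leafsets T r); [exact: leafsets_hierarchy|exact: type_coneE].
by exists (hierarchy_tree hn hF); rewrite type_coneE hierarchy_tree_leafsets.
Qed.

Lemma split_weight_gt0 (G : trop_curve R n) I : I \in leafsets G r ->
  0 < split_weight (@len R n G) I.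
Proof.
case/imsetP=> v; rewrite !inE => vr ->; rewrite split_weight_leafset //.
by apply: len_gt0; rewrite adj_sym; case: (parentP vr).
Qed.

Lemma phi_inj (G H : trop_curve R n) : phi G = phi H <-> curve_iso G H.
Proof.
split=> [|[f [fbij fadj fend flen]]]; last first.
  congr (qproj _ _); apply/ffunP => p; rewrite !ffunE -!fend.
  by rewrite (curve_iso_tree_dist (bij_inj fbij) fadj flen).
rewrite /phi !qproj_dist_vec => e.
have hG := leafsets_hierarchy G r; have hH := leafsets_hierarchy H r.
have ge0 (G' : trop_curve R n) I : I \in leafsets G' r -> 0 <= split_weight (@len R n G') I.
  by move/split_weight_gt0/ltW.
have eF : leafsets G r = leafsets H r.
  apply/eqP; rewrite eqEsubset; apply/andP; split; apply/subsetP => I IF.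
    exact: (hcone_support hG hH (ge0 G) (ge0 H) e IF (split_weight_gt0 IF)).
  exact: (hcone_support hH hG (ge0 H) (ge0 G) (esym e) IF (split_weight_gt0 IF)).
apply: (leafsets_curve_iso hn eF) => v w vr evw.
have vG : leafset r v \in leafsets G r by rewrite mem_leafsets.
have wr : w != end_at H r by move: vG; rewrite eF evw mem_leafsets.
rewrite -!split_weight_leafset // -evw.
by apply: (hcone_coef hG hH (ge0 G) (ge0 H) e vG); rewrite -eF.
Qed.

(** Contracting the edges of length 0 of a degenerate curve amounts to dropping
    the corresponding clusters. *)
Lemma bigcup_moduli_fan : \bigcup_(C in moduli_fan R n) C = moduli_image R n.
Proof.
apply/seteqP; split=> q; last first.
  move=> [G ->]; exists (type_cone G); first by exists G.
  by exists (@len R n G) => // x y xy; apply/ltW/len_gt0.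
move=> [C /moduli_fanP[F hF ->] [c c0 qE]].
pose F0 := [set I in F | 0 < c I]%SET.
have F0F : F0 \subset F by apply/subsetP => I; rewrite inE => /andP[].
have hF0 := subset_hierarchy F0F hF.
have T0 : leafsets (hierarchy_tree hn hF0) r = F0 := hierarchy_tree_leafsets hn hF0.
have len0 : forall I, I \in leafsets (hierarchy_tree hn hF0) r -> 0 < c I.
  by rewrite T0 => I; rewrite inE => /andP[].
exists (TropCurve (weight_len_gt0 len0)); rewrite /phi qproj_weight_len /= T0 qE.
rewrite (big_setID F0) /= (setIidPr F0F) [X in _ + X]big1 ?addr0 // => I /setDP[IF].
rewrite inE IF /= -leNgt => cI; suff -> : c I = 0 by rewrite scale0r.
by apply/eqP; rewrite eq_le cI c0.
Qed.

End HierarchyCones.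

(** * The fan *)

Section ModuliFan.
Local Open Scope classical_set_scope.
Variables (R : realType) (n : nat) (r : 'I_n).
Hypothesis hn : (2 < n)%N.
Implicit Types (F G : {set {set 'I_n}}) (I J K P S : {set 'I_n}) (C : set (Qn R n)).

Let L := split_lattice R n.
Local Notation sv := (@sv R n).
Local Notation hcone := (@hcone R n).

Lemma exists_leafpair : exists S, leafpair r S.
Proof.
have : (1 < #|top r|)%N by rewrite card_top; lia.
case/card_gt1P=> a [b [aT bT ab]]; exists [set a; b]%SET.
by apply: leafpair_set2 => //; move: aT bT; rewrite !inE ![r == _]eq_sym.
Qed.

(** The differences of the Gromov products with that of one fixed pair are
    integral and separate points, and they are dual to the vectors of the other
    pairs, which therefore form a basis. *)
Lemma split_lattice_is_lattice : is_lattice L.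
Proof.
have [S0 pS0] := exists_leafpair.
pose B := [set S | leafpair r S & S != S0]%SET.
pose u S := gdiff R r S S0.
have sub_top S : leafpair r S -> S \subset top r.
  by move=> /andP[_ rS]; apply/subsetP => i iS; rewrite !inE; apply: contraNneq rS => <-.
have sub_eq S S' : leafpair r S -> leafpair r S' -> (S \subset S') = (S == S').
  move=> /andP[/eqP cS _] /andP[/eqP cS' _].
  by apply/idP/eqP => [sSS|->//]; apply/eqP; rewrite eqEcard sSS cS cS'.
have cB S : S \in B -> cluster r S.
  rewrite inE => /andP[pS SS0]; have /andP[/eqP cS rS] := pS.
  rewrite /cluster rS cS /= -(card_top r) -cS; apply: proper_card.
  rewrite properEneq sub_top // andbT; apply: contraNneq SS0 => eS.
  by rewrite eq_sym -sub_eq // eS sub_top.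
have svL S : S \in B -> zspan (sv @` [set I | cluster r I]) (sv S).
  by move=> /cB cS; apply: zspan_gen; exists S.
have uL S : S \in B -> dual_lattice (zspan (sv @` [set I | cluster r I])) (u S).
  by move=> _; rewrite -split_latticeE; apply: gdiff_dual.
have uv S S' : S \in B -> S' \in B -> u S (sv S') = (S == S')%:R.
  rewrite !inE => /andP[pS SS0] /andP[pS' S'S0]; have /andP[_ rS'] := pS'.
  by rewrite gdiff_sv // !sub_eq // [S0 == _]eq_sym (negPf S'S0) subr0.
have xE x : x = \sum_(S in B) u S x *: sv S.
  apply/eqP; rewrite -subr_eq0; apply/eqP/(gdiffs_sep (r := r)).
  set y := x - _.
  have y0 S : leafpair r S -> gdiff R r S S0 y = 0.
    move=> pS; have [->|SS0] := eqVneq S S0.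
      by rewrite lfunE /= /gromov_diff pS0 /= subrr.
    have SB : S \in B by rewrite inE pS.
    by rewrite linearB /= -/(u S) (coord_sum uv) ?subxx // SB mul1r subrr.
  move=> S S'; have [/andP[pS pS']|p] := boolP (leafpair r S && leafpair r S'); last first.
    by rewrite lfunE /= /gromov_diff (negPf p).
  have := y0 S' pS'; have := y0 S pS; rewrite !lfunE /= /gromov_diff pS pS' pS0 /=.
  by move/eqP; rewrite subr_eq0 => /eqP->; move/eqP; rewrite subr_eq0 => /eqP->; rewrite subrr.
have fullB : linspan (cone sv B) = fullv.
  by apply/vspaceP => x; rewrite memvf; apply/(linspan_coneP uv).
exists [seq sv P | P <- enum B].
  rewrite /basis_of -linspan_cone fullB eqxx.
  by apply: (free_cone uv) => [|S]; rewrite ?enum_uniq // mem_enum.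
have := sublattice_cone svL uL uv; rewrite -split_latticeE /sublattice fullB.
have -> : [set` fullv] `&` split_lattice R n = L.
  by apply/seteqP; split=> [x []//|x Lx]; split=> //; rewrite /= memvf.
move=> ->; congr zspan; apply/seteqP; split=> x.
  by move=> [P PB <-]; apply/mapP; exists P; rewrite ?mem_enum.
by move=> /mapP[P]; rewrite mem_enum => PB ->; exists P.
Qed.

Lemma moduli_is_fan : is_fan L (moduli_fan R n).
Proof.
split.
- have -> : moduli_fan R n = hcone @` [set F | hierarchy r F].
    apply/seteqP; split=> C; first by move/(moduli_fanP r hn) => [F hF ->]; exists F.
    by move=> [F hF <-]; apply/(moduli_fanP r hn); exists F.
  by apply: finite_image; apply: finite_finset.
- by move=> C /(moduli_fanP r hn)[F hF ->]; exact: (hcone_is_cone R hn hF).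
- move=> C C' /(moduli_fanP r hn)[F hF ->] /(face_hcone r)[G GF ->].
  by apply/(moduli_fanP r hn); exists G => //; apply: subset_hierarchy hF.
- move=> C C' /(moduli_fanP r hn)[F hF ->] /(moduli_fanP r hn)[F' hF' ->].
  rewrite (hcone_setI R hF hF'); split; first exact: (hcone_face R hn hF (subsetIl _ _)).
  exact: (hcone_face R hn hF' (subsetIr _ _)).
Qed.

(** A cone with fewer than [n - 3] generators belongs to a hierarchy with a node
    of at least three children, which can be refined. *)
Lemma moduli_pure_dim : pure_dim (moduli_fan R n) (n - 3).
Proof.
move=> C /(moduli_fanP r hn)[F hF ->] Cmax; rewrite (cdim_hcone R hn hF).
apply/eqP; rewrite eqn_leq (card_hierarchy hn hF) leqNgt /=; apply/negP => lt.
have [J Jn J3] := exists_ternary hn hF lt.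
have [K KJ] : exists K, K \in children r F J.
  by apply/set0Pn; rewrite -card_gt0 ltnW // ltnW.
have [hI /negP[]] := cut_child hn hF Jn J3 KJ; set I := (J :\: K)%SET in hI *.
suff -> : F = (I |: F)%SET by rewrite setU11.
apply/esym/(hcone_inj hn hI hF)/Cmax; first by apply/(moduli_fanP r hn); exists (I |: F)%SET.
by apply: sub_hcone; apply: subsetUr.
Qed.

Lemma hierarchy_set1 I : cluster r I -> hierarchy r [set I]%SET.
Proof.
move=> cI; split=> [J|J K]; first by rewrite inE => /eqP->.
by rewrite !inE => /eqP-> /eqP->; rewrite /nested subxx.
Qed.

Lemma split_marking_ray I : cluster r I -> split_marking R n (hcone [set I]%SET) = sv I.
Proof.
move=> cI; rewrite /split_marking; set P := [set v | _].
have : P (xget 0 P).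
  apply: xgetPex; exists (sv I); split; last exact: hcone_set1.
  by rewrite (range_split_vec R r); exists I.
case; rewrite (range_split_vec R r) => -[J cJ eJ]; rewrite -eJ.
rewrite -hcone_set1 => e; congr (sv _).
have := hcone_inj hn (hierarchy_set1 cI) (hierarchy_set1 cJ) e.
by move/setP/(_ I); rewrite !inE eqxx => /esym/eqP.
Qed.

Lemma moduli_rayP C : kcones (moduli_fan R n) 1 C <->
  exists2 I, cluster r I & C = hcone [set I]%SET.
Proof.
split=> [[/(moduli_fanP r hn)[F hF ->]]|[I cI ->]].
  rewrite (cdim_hcone R hn hF) => /eqP/cards1P[I eF]; exists I; last by rewrite eF.
  by apply: (proj1 hF); rewrite eF inE.
have hI := hierarchy_set1 cI; split; last by rewrite (cdim_hcone R hn hI) cards1.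
by apply/(moduli_fanP r hn); exists [set I]%SET.
Qed.

Lemma sv_neq0 I : cluster r I -> sv I <> 0.
Proof.
move=> cI e; have [u [_ /(_ I I)]] := hierarchy_dual R hn (hierarchy_set1 cI).
rewrite inE eqxx => /(_ isT isT); rewrite e linear0 => /eqP.
by rewrite eq_sym oner_eq0.
Qed.

Lemma moduli_marked_fan :
  marked_fan L (moduli_fan R n) (n - 3) (split_marking R n).
Proof.
split; [exact: moduli_is_fan|exact: moduli_pure_dim| |].
  by move=> C /(moduli_fanP r hn)[F hF ->]; exact: (hcone_simplicial R hn hF).
move=> C /moduli_rayP[I cI ->]; rewrite split_marking_ray //; split.
- by apply: mem_cone; rewrite inE.
- exact: sv_neq0.
- exact: sv_lattice cI.
Qed.

Lemma split_marking_rays :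
  split_marking R n @` kcones (moduli_fan R n) 1 = range (split_vec R n).
Proof.
rewrite (range_split_vec R r); apply/seteqP; split=> v.
  by move=> [C /moduli_rayP[I cI ->] <-]; rewrite split_marking_ray //; exists I.
move=> [I cI <-]; exists (hcone [set I]%SET); last exact: split_marking_ray.
by apply/moduli_rayP; exists I.
Qed.

(** The clusters of a hierarchy are part of a lattice basis, so they generate
    the whole lattice of their cone. *)
Lemma marked_weight_hcone F : hierarchy r F ->
  marked_weight L (split_marking R n) (hcone F) = 1%N.
Proof.
move=> hF; rewrite /marked_weight.
have -> : marked_sublattice L (split_marking R n) (hcone F) = sublattice L (hcone F).
  rewrite (sublattice_hcone R hn hF) /marked_sublattice; congr zspan.
  apply/seteqP; split=> v.
    move=> [C [/(face_hcone r)[G GF ->]]].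
    have hG := subset_hierarchy GF hF; rewrite (cdim_hcone R hn hG) => /eqP/cards1P[I eG] <-.
    have IF : I \in F by apply: (subsetP GF); rewrite eG inE.
    by exists I => //; rewrite eG split_marking_ray //; apply: (proj1 hF).
  move=> [I IF <-]; have cI := proj1 hF I IF.
  exists (hcone [set I]%SET); last exact: split_marking_ray.
  split; first by apply: (hcone_face R hn hF); rewrite sub1set.
  by rewrite (cdim_hcone R hn (hierarchy_set1 cI)) cards1.
set A := sublattice L (hcone F).
have AE : A = zspan (sv @` [set` F]) := sublattice_hcone R hn hF.
have A0 : A 0 by rewrite AE; apply: zspan0.
have -> : cosets A A = [set A].
  apply/seteqP; split=> B.
    move=> [x Ax <-] /=; apply/seteqP; split=> [_ [y Ay <-]|y Ay].
      by rewrite AE in Ax Ay *; apply: zspanD.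
    exists (y - x); last by rewrite addrC subrK.
    by rewrite AE in Ax Ay *; apply: zspanD => //; rewrite -mulrN1z; apply: zspanMz.
  move=> /= ->; exists 0 => //; apply/seteqP; split=> [_ [y Ay <-]|y Ay].
    by rewrite add0r.
  by exists y => //; rewrite add0r.
by rewrite fset_set1 cardfs1.
Qed.

(** * Balancing *)

(** Applied to the whole set of leaves other than [r] and to the single leaves,
    which correspond to ends rather than to bounded edges. *)
Lemma sv_unseparated I : r \notin I ->
  (forall S S', leafpair r S -> leafpair r S' -> (S \subset I) = (S' \subset I)) ->
  sv I = 0.
Proof.
move=> rI H; apply: (gdiffs_sep (r := r)) => S S'.
have [/andP[pS pS']|p] := boolP (leafpair r S && leafpair r S').
  by rewrite gdiff_sv // (H S S') // subrr.
by rewrite lfunE /= /gromov_diff (negPf p).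
Qed.

Lemma sv_top : sv (top r) = 0.
Proof.
have sub_top S : leafpair r S -> S \subset top r.
  by move=> /andP[_ rS]; apply/subsetP => i iS; rewrite !inE; apply: contraNneq rS => <-.
by apply: sv_unseparated => [|S S' pS pS']; rewrite ?inE ?eqxx // !sub_top.
Qed.

Lemma sv_set1 i : i != r -> sv [set i]%SET = 0.
Proof.
have not_sub S : leafpair r S -> S \subset [set i]%SET = false.
  by move=> /andP[/eqP cS _]; apply/negP => /subset_leq_card; rewrite cS cards1.
move=> ir; apply: sv_unseparated => [|S S' pS pS']; first by rewrite inE eq_sym.
by rewrite !not_sub.
Qed.

Lemma sv_linspan F I : I \in tree_nodes r F -> sv I \in linspan (hcone F).
Proof.
case/setUP=> [/setU1P[->|IF]|/imsetP[i it ->]].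
- by rewrite sv_top mem0v.
- by apply: (proj1 (linspanP (hcone F))); apply: mem_cone.
- by rewrite sv_set1 ?mem0v //; move: it; rewrite !inE.
Qed.

Section Ternary.
Variables (F : {set {set 'I_n}}) (J : {set 'I_n}).
Hypotheses (hF : hierarchy r F) (Jn : J \in (top r |: F)%SET)
  (J3 : #|children r F J| = 3%N).

(** If a and b lie in the children A and B of [J], then, for each child [K],
    K <> A and K <> B is counted as 1 - [K = A] - [K = B] + [K = A = B]. *)
Lemma ternary_count S : leafpair r S ->
  (\sum_(K in children r F J) (S \subset J :\: K)%SET =
   (S \subset J) + \sum_(K in children r F J) (S \subset K))%N.
Proof.
move=> /leafpairP[a [b [ab _ _ eS]]]; have [SJ|SJ] := boolP (S \subset J); last first.
  rewrite !big1 // => K KJ.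
    by apply/eqP; rewrite eqb0; apply: contra SJ => /subset_trans; apply; apply/proper_sub/(child_proper hF).
  by apply/eqP; rewrite eqb0; apply: contra SJ => /subset_trans; apply; apply: subsetDl.
move: (SJ); rewrite {1}eS subUset !sub1set => /andP[aJ bJ].
have [A AJ aA] := mem_child hn hF Jn aJ; have [B BJ bB] := mem_child hn hF Jn bJ.
have inA K : K \in children r F J -> (a \in K) = (K == A).
  by move=> KJ; apply/idP/eqP => [aK|->//]; exact: (child_meet_eq hn hF KJ AJ aK aA).
have inB K : K \in children r F J -> (b \in K) = (K == B).
  by move=> KJ; apply/idP/eqP => [bK|->//]; exact: (child_meet_eq hn hF KJ BJ bK bB).
have sum1 D : D \in children r F J -> (\sum_(K in children r F J) (K == D) = 1)%N.
  move=> DJ; rewrite (bigD1 D) //= eqxx big1 // => K /andP[_ /negPf->//].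
have : (\sum_(K in children r F J) (S \subset J :\: K)%SET +
    (\sum_(K in children r F J) (K == A) + \sum_(K in children r F J) (K == B)) =
    \sum_(K in children r F J) 1 + \sum_(K in children r F J) (S \subset K))%N.
  rewrite -!big_split; apply: eq_bigr => K KJ.
  rewrite eS !subUset !sub1set !inE aJ bJ !andbT inA // inB //.
  by case: (K == A); case: (K == B).
rewrite !sum1 // sum1_card J3.
by move: (\sum_(K in _) _)%N (\sum_(K in _) _)%N => x y; lia.
Qed.

(** In Gromov coordinates: a pair inside one child lies in two of the three
    unions, and in [J] and that child; a pair of leaves from two children lies
    in one union, and in [J]. *)
Lemma ternary_balance : \sum_(K in children r F J) sv (J :\: K)%SET =
  sv J + \sum_(K in children r F J) sv K.
Proof.
apply/eqP; rewrite -subr_eq0; apply/eqP/(gdiffs_sep (r := r)) => S S'.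
have [/andP[pS pS']|p] := boolP (leafpair r S && leafpair r S'); last first.
  by rewrite lfunE /= /gromov_diff (negPf p).
have rJ : r \notin J.
  by apply/negP => /(subsetP (node_subset_top hF Jn)); rewrite !inE eqxx.
have E (f : {set 'I_n} -> {set 'I_n}) :
    (forall K, K \in children r F J -> f K \subset J) ->
    gdiff R r S S' (\sum_(K in children r F J) sv (f K)) =
    (\sum_(K in children r F J) (S \subset f K))%:R -
    (\sum_(K in children r F J) (S' \subset f K))%:R.
  move=> fJ; rewrite linear_sum !natr_sum -sumrB; apply: eq_bigr => K KJ.
  by rewrite /= gdiff_sv //; apply: contra rJ => /(subsetP (fJ K KJ)).
rewrite linearB linearD /= !E => [|K /(child_proper hF)/proper_sub//|K _]; last exact: subsetDl.
rewrite gdiff_sv // !ternary_count // !natrD.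
by rewrite opprD addrACA subrr.
Qed.

Let cut K := ((J :\: K) |: F)%SET.

Lemma cut_hierarchy K : K \in children r F J -> hierarchy r (cut K).
Proof. by move=> KJ; case: (cut_child hn hF Jn _ KJ) => //; rewrite J3. Qed.

Lemma cut_notin K : K \in children r F J -> (J :\: K)%SET \notin F.
Proof. by move=> KJ; case: (cut_child hn hF Jn _ KJ) => //; rewrite J3. Qed.

Lemma cut_inj K K' : K \in children r F J -> K' \in children r F J ->
  hcone (cut K) = hcone (cut K') -> K = K'.
Proof.
move=> KJ KJ' /(hcone_inj hn (cut_hierarchy KJ) (cut_hierarchy KJ')) /setP/(_ (J :\: K)%SET).
rewrite setU11 => /esym/setU1P[e|]; last by rewrite (negPf (cut_notin KJ)).
have subJ D : D \in children r F J -> (J :\: (J :\: D))%SET = D.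
  by move=> /(child_proper hF)/proper_sub DJ; rewrite setDDr setDv set0U; apply/setIidPr.
by rewrite -(subJ K KJ) e subJ.
Qed.

(** Modulo the span of [hcone F] all generators but the new one vanish. *)
Lemma cut_primitive_normal K : K \in children r F J ->
  is_primitive_normal L (hcone (cut K)) (qproj (linspan (hcone F)) (sv (J :\: K)%SET)).
Proof.
move=> KJ; split; last first.
  by exists (sv (J :\: K)%SET) => //; apply: mem_cone; rewrite setU11.
rewrite (sublattice_hcone R hn (cut_hierarchy KJ)); apply/seteqP; split=> q.
  move=> [k _ <-]; exists (sv (J :\: K)%SET *~ k); last by rewrite raddfMz.
  by apply/zspanMz/zspan_gen; exists (J :\: K)%SET => //; rewrite /= setU11.
move=> [_ [s sG ->] <-]; rewrite raddf_sum big_seq.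
apply: (big_ind (fun y => range (fun k : int => qproj (linspan (hcone F)) (sv (J :\: K)%SET) *~ k) y)).
- by exists 0.
- by move=> _ _ [k _ <-] [m _ <-]; exists (k + m); rewrite // mulrzDr.
move=> p /sG[I /setU1P[->|IF] <-] /=; first by exists p.1; rewrite ?raddfMz.
exists 0 => //; rewrite mulr0z raddfMz /=; apply/esym/eqP.
have -> : qproj (linspan (hcone F)) (sv I) = 0; last by rewrite mul0rz.
by apply/eqP; rewrite qproj_eq0 sv_linspan // !inE IF orbT.
Qed.

Hypothesis cF : #|F|.+1 = (n - 3)%N.

Lemma star_cuts :
  kcones (moduli_fan R n) (n - 3) `&` [set C | is_face L (hcone F) C] =
  (fun K => hcone (cut K)) @` [set` children r F J].
Proof.
apply/seteqP; split=> C.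
  move=> [[/(moduli_fanP r hn)[G hG ->]]]; rewrite (cdim_hcone R hn hG) => cG.
  move=> /= /(face_hcone r)[F' F'G] /(hcone_inj hn hF (subset_hierarchy F'G hG)) eF.
  have FG : F \subset G by rewrite eF.
  have /cards1P[I eI] : #|G :\: F|%SET == 1%N.
    by rewrite cardsD (setIidPr FG) cG -cF subSnn.
  have eG : G = (I |: F)%SET by rewrite -eI setUC -{1}(setID G F) (setIidPr FG).
  have IF : I \notin F.
    by have : I \in (G :\: F)%SET; [rewrite eI inE | rewrite inE => /andP[]].
  have Pn := par_node r F I; have uniqJ := proj2 (unique_ternary hn hF cF Jn _).
  rewrite J3 in uniqJ; have {}uniqJ := uniqJ isT.
  have hI : hierarchy r (I |: F)%SET by rewrite -eG.
  have [|P3 [K KP IE]] := refinement_cut hn hF hI IF.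
    by rewrite leqNgt; apply/negP => P4; have eP := uniqJ _ Pn (ltnW P4); rewrite eP J3 in P4.
  have PJ := uniqJ _ Pn P3; rewrite PJ in KP IE.
  by exists K; rewrite ?eG ?IE.
move=> [K KJ <-]; have hG := cut_hierarchy KJ; split.
  split; first by apply/(moduli_fanP r hn); exists (cut K).
  by rewrite (cdim_hcone R hn hG) cardsU1 cut_notin // add1n.
exact: (hcone_face R hn hG (subsetUr _ _)).
Qed.

End Ternary.

Lemma moduli_tropical_fan : tropical_fan L (moduli_fan R n) (n - 3)
  (marked_weight L (split_marking R n)).
Proof.
split.
  split; [exact: moduli_is_fan|exact: moduli_pure_dim|].
  by move=> C [/(moduli_fanP r hn)[F hF ->] _]; rewrite marked_weight_hcone.
move=> C0 /(moduli_fanP r hn)[F hF ->]; rewrite (cdim_hcone R hn hF) => cF star.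
have [J Jn J3'] : exists2 J, J \in (top r |: F)%SET & (2 < #|children r F J|)%N.
  by apply: exists_ternary; rewrite // -cF.
have [J3 _] := unique_ternary hn hF cF Jn J3'.
pose cut K := ((J :\: K) |: F)%SET.
pose u C := qproj (linspan (hcone F)) (xget 0
  [set v | exists2 K, K \in children r F J & C = hcone (cut K) /\ v = sv (J :\: K)%SET]).
have uE K : K \in children r F J ->
    u (hcone (cut K)) = qproj (linspan (hcone F)) (sv (J :\: K)%SET).
  move=> KJ; rewrite /u; set P := [set v | _]; have [K' KJ' [eK ->]] : P (xget 0 P).
    by apply: xgetPex; exists (sv (J :\: K)%SET), K.
  by rewrite (cut_inj hF Jn J3 KJ KJ' eK).
have starE : star = (fun K => hcone (cut K)) @` [set` children r F J].
  exact: star_cuts.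
exists u => [C|]; rewrite starE.
  by move=> [K KJ <-]; rewrite uE //; apply: cut_primitive_normal.
rewrite fsbig_image => [|K K']; last first.
  by move=> /set_mem KJ /set_mem KJ'; apply: (cut_inj hF Jn J3).
have -> : [set` children r F J] = [set` enum (children r F J)].
  by apply/seteqP; split=> K /=; rewrite mem_enum.
rewrite -fsbig_seq ?enum_uniq // big_enum /=.
transitivity (qproj (linspan (hcone F)) (\sum_(K in children r F J) sv (J :\: K)%SET)).
  rewrite raddf_sum; apply: eq_bigr => K KJ.
  by rewrite uE // marked_weight_hcone ?mulr1n //; apply: cut_hierarchy.
apply/eqP; rewrite qproj_eq0 (ternary_balance hF Jn J3) memvD //.
  by apply: sv_linspan; rewrite inE Jn.
by apply: memv_suml => K KJ; apply: sv_linspan; apply: child_tree_node KJ.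
Qed.

End ModuliFan.

Local Open Scope classical_set_scope.
Local Open Scope ring_scope.

Theorem theorem3p7 (R : realType) (n : nat) (hn : (3 <= n)%N) :
  (forall G H : trop_curve R n, phi G = phi H <-> curve_iso G H) /\
  \bigcup_(C in moduli_fan R n) C = moduli_image R n /\
  is_lattice (split_lattice R n) /\
  marked_fan (split_lattice R n) (moduli_fan R n) (n - 3) (split_marking R n) /\
  split_marking R n @` kcones (moduli_fan R n) 1 = range (split_vec R n) /\
  tropical_fan (split_lattice R n) (moduli_fan R n) (n - 3)
    (marked_weight (split_lattice R n) (split_marking R n)).
Proof.
have n0 : (0 < n)%N by apply: leq_trans hn.
pose r := Ordinal n0.
split; first exact: (phi_inj r hn).
split; first exact: (bigcup_moduli_fan R r hn).
split; first exact: (split_lattice_is_lattice R r hn).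
split; first exact: (moduli_marked_fan R r hn).
split; [exact: (split_marking_rays R r hn)|exact: (moduli_tropical_fan R r hn)].
Qed.
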